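(* Let $n\ge 4$ be an integer. Let $\phi\in C^2(\mathbb{R}_+)$ and $\psi\in C^1(\mathbb{R}_+)$ satisfy $$\sum_{i=0}^2 \langle r\rangle^i |\phi^{(i)}(r)| + \sum_{i=0}^1 \langle r\rangle^{i+1}|\psi^{(i)}(r)| \le \varepsilon \langle r\rangle^{-k}\qquad (r>0)$$ for some $\varepsilon,k>0$. Suppose $F\in C^1(\mathbb{R})$ satisfies $F(0)=F'(0)=0$ and $|F'(u)-F'(v)|\le Ap|u-v|^{p-1}$ for all $u,v\in\mathbb{R}$, for some $A>0$ and some $p_n<p<1+\frac{4}{n-1}$, where $p_n$ is the positive root of $(n-1)p^2=(n+1)p+2$. Assume that $V\in C^1(\mathbb{R}_+)$ satisfies $\sum_{i=0}^1 \langle r\rangle^i|V^{(i)}(r)|\le V_0\langle r\rangle^{-\kappa}$ for all $r>0$, for some $V_0>0$ and $\kappa>2$. Assume $k\ge 2/(p-1)$ and that $V_0,\varepsilon$ are sufficiently small. Let $u_0^-$, $u$, $u_0^+$ be, respectively, the free solution with data $(\phi,\psi)$, the solution of the nonlinear equation, and the free solution furnished by the existence theorem recalled in the context. Define the energy norm $$\|w(\cdot,t)\|_e=\left(\int_0^\infty\left(|\partial_rw(r,t)|^2+|\partial_tw(r,t)|^2\right)r^{n-1}\,dr\right)^{1/2}.$$ If $k>m+1$, then $$\|u(\cdot,t)-u_0^-(\cdot,t)\|_e\le C\|u\|\cdot\langle t\rangle^{-\theta},\quad t\le0;$$ $$\|u(\cdot,t)-u_0^+(\cdot,t)\|_e\le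 C\|u\|\cdot\langle t\rangle^{-\theta},\quad t\ge0.$$ Here the constant $C$ is independent of $t$ and $$\theta=\min\bigl((a+m)(p-1)-1,\ (k-m)p-1,\ k-m-1\bigr)>0.$$
   Context: Notation: $\langle s\rangle=1+|s|$; $\mathbb{R}_+=(0,\infty)$; $\Omega=(0,\infty)\times\mathbb{R}$. The parameters $(a,m)$ are $(1,\frac{n-3}{2})$ if $n$ is odd and $(\frac12,\frac{n-2}{2})$ if $n$ is even. The weight function is $$W_k(r,|t|)=\langle |t|+r\rangle^a\,\langle |t|-r\rangle^\nu,\qquad \nu=k-m-a.$$ The Banach space $X$ consists of all $u=u(r,t)\in C^1(\Omega)$ with $\|u\|<\infty$, where $$\|u\|=\sum_{j=0}^1\ \sup_{(r,t)\in\Omega}|\partial_r^ju(r,t)|\cdot r^{m-1+j}\langle r\rangle^{1-j}\cdot W_k(r,|t|).$$ The function $u_0^-$ is the one given by the following known lemma: if $n\ge4$ and $\phi\in C^2(\mathbb{R}_+)$, $\psi\in C^1(\mathbb{R}_+)$ satisfy the decay condition of the claim for some $\varepsilon>0$ and some $(n-1)/2<k<n-1$, then the homogeneous equation $\partial_t^2u_0-\partial_r^2u_0-\frac{n-1}{r}\partial_ru_0=0$ in $\Omega$ with $u_0(r,0)=\phi(r)$, $\partial_tu_0(r,0)=\psi(r)$ admits a unique solution $u_0^-\in C^1(\Omega)$ satisfying $|\partial_r^ju_0^-(r,t)|+|\partial_t^ju_0^-(r,t)|\le C_0(k,n)\,\varepsilon\, r^{1-m-j}\langle r\rangle^{j-1}W_k(r,|t|)^{-1}$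 for $j=0,1$. (Data satisfying the decay condition with exponent $k$ also satisfy it with any smaller exponent.) Existence theorem. Under the hypotheses of the claim preceding the assumption $k>m+1$, with $D=(\partial_r,\partial_t)$ and multi-indices $|\beta|\le1$: (a) there exists a unique solution $u\in X$ to $\partial_t^2u-\partial_r^2u-\frac{n-1}{r}\partial_ru=F(u)-V(r)u$ in $\Omega$ such that $|D^\beta(u-u_0^-)(r,t)|\le C\|u\|\, r^{1-|\beta|-m}\langle r\rangle^{|\beta|-1}W_k(r,|t|)^{-1}$ for some constant $C$ independent of $r,t$; besides, $\|u\|\le1$; (b) there exists a unique solution $u_0^+\in X$ to $\partial_t^2u_0-\partial_r^2u_0-\frac{n-1}{r}\partial_ru_0=0$ in $\Omega$ such that $|D^\beta(u-u_0^+)(r,t)|\le C\|u\|\, r^{1-|\beta|-m}\langle r\rangle^{|\beta|-1}W_k(r,|t|)^{-1}$ for some constant $C$ independent of $r,t$.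
   Formalization: The recalled theorem's bounds do not determine u or u_0^+ (if F=V=φ=ψ=0, any small free solution fits), so u−u_0^- and u−u_0^+ are also required to be the Duhamel integrals of F(u)−Vu from t=−∞ and t=+∞. *)

(* Defs.v *)
From mathcomp Require Export all_boot all_order all_algebra.
From mathcomp Require Export all_classical all_reals all_analysis.

Set Implicit Arguments.
Unset Strict Implicit.
Unset Printing Implicit Defensive.

Import Order.TTheory GRing.Theory Num.Theory.
Import numFieldNormedType.Exports.

Local Open Scope classical_set_scope.
Local Open Scope ring_scope.

Definition jap (R : realType) (s : R) : R := 1 + `|s|.

(** ** Parameters *)

Definition a_par (R : realType) (n : nat) : R := if odd n then 1 else 2^-1.

Definition m_par (R : realType) (n : nat) : R :=
  if odd n then (n%:R - 3) / 2 else (n%:R - 2) / 2.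

Definition theta (R : realType) (n : nat) (k p : R) : R :=
  let a := a_par R n in let m := m_par R n in
  Num.min ((a + m) * (p - 1) - 1) (Num.min ((k - m) * p - 1) (k - m - 1)).

(** ** Regularity *)

(** [C^j] on the open half-line (0, +oo); values of [f] elsewhere are
    irrelevant. *)
Definition Ck_pos (R : realType) (j : nat) (f : R -> R) : Prop :=
  forall r : R, 0 < r ->
    (forall i : nat, (i < j)%N -> derivable (derive1n i f) r 1) /\
    {for r, continuous (derive1n j f)}.

Definition C1_line (R : realType) (f : R -> R) : Prop :=
  (forall x : R, derivable f x 1) /\ continuous (derive1 f).

(** Functions on Omega = (0, +oo) x R are total functions [u r t], only used at
    points with [0 < r].  [pderiv i j u] is d_r^i d_t^j u. *)
Definition pderiv (R : realType) (i j : nat) (u : R -> R -> R) (r t : R) : R :=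
  derive1n i (fun x : R => derive1n j (u x) t) r.

Definition C1_Omega (R : realType) (u : R -> R -> R) : Prop :=
  forall r t : R, 0 < r ->
    [/\ derivable (fun x : R => u x t) r 1,
        derivable (u r) t 1,
        {for (r, t), continuous (fun z : R * R => pderiv 1 0 u z.1 z.2)} &
        {for (r, t), continuous (fun z : R * R => pderiv 0 1 u z.1 z.2)}].

(** ** The space X *)

(** [weight n k r s] is W_k(r, s), to be used with s = |t|. *)
Definition weight (R : realType) (n : nat) (k r s : R) : R :=
  let a := a_par R n in let m := m_par R n in
  jap (s + r) `^ a * jap (s - r) `^ (k - m - a).

(** An extended real: it is [+oo] when a supremum is infinite. *)
Definition normX (R : realType) (n : nat) (k : R) (u : R -> R -> R) : \bar R :=
  (\sum_(0 <= j < 2)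
    ereal_sup [set ((`|pderiv j 0 u z.1 z.2|
                     * z.1 `^ (m_par R n - 1 + j%:R)
                     * jap z.1 `^ (1 - j%:R)
                     * weight n k z.1 `|z.2|)%:E : \bar R)
              | z in [set z : R * R | 0 < z.1]%R])%E.

Definition in_X (R : realType) (n : nat) (k : R) (u : R -> R -> R) : Prop :=
  C1_Omega u /\ (normX n k u < +oo)%E.

(** ** Radial wave equation *)

(** [w] is in C^1(Omega) and satisfies
      d_t^2 w - d_r^2 w - (n-1)/r d_r w = G   in Omega.
    As [w] is only C^1, the equation is taken in the weak sense: it is
    multiplied by r^(n-1) eta, which puts it in the divergence form
      r^(n-1) d_t^2 w - d_r (r^(n-1) d_r w) = r^(n-1) G,
    and integrated by parts once, for every C^1 function eta with compact
    support in Omega. *)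
Definition compact_supp_Omega (R : realType) (eta : R -> R -> R) : Prop :=
  exists c d T : R, 0 < c /\
    forall r t : R, 0 < r -> ~~ [&& c <= r, r <= d & `|t| <= T] ->
      eta r t = 0.

Definition wave_sol (R : realType) (n : nat) (G w : R -> R -> R) : Prop :=
  C1_Omega w /\
  forall eta : R -> R -> R, C1_Omega eta -> compact_supp_Omega eta ->
    \int[@lebesgue_measure R]_t \int[@lebesgue_measure R]_(r in `]0, +oo[)
      ((pderiv 1 0 w r t * pderiv 1 0 eta r t
        - pderiv 0 1 w r t * pderiv 0 1 eta r t) * r ^+ n.-1)
    = \int[@lebesgue_measure R]_t \int[@lebesgue_measure R]_(r in `]0, +oo[)
      (G r t * eta r t * r ^+ n.-1).

(** |D^beta w| <= B r^(1-|beta|-m) <r>^(|beta|-1) W_k(r,|t|)^(-1) in Omega for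
    |beta| <= 1. *)
Definition D_bound (R : realType) (n : nat) (k B : R) (w : R -> R -> R) : Prop :=
  forall (i j : nat) (r t : R), (i + j <= 1)%N -> 0 < r ->
    `|pderiv i j w r t| <=
      B * r `^ (1 - (i + j)%:R - m_par R n) * jap r `^ ((i + j)%:R - 1)
        * (weight n k r `|t|)^-1.

(** ** Duhamel operators *)

(** [z] is the solution of the wave equation with source [G] and zero Cauchy
    data at time [T], i.e. the Duhamel integral of [G] from [T] to [t].  The
    last clause is the growth allowed at r = 0 for C^1 solutions (it is the one
    in the definition of X); it excludes solutions that are singular on the
    axis, such as those behaving like r^(2-n). *)
Definition zero_data_sol (R : realType) (n : nat) (G : R -> R -> R) (T : R)
    (z : R -> R -> R) : Prop :=
  [/\ wave_sol n G z,
      forall r : R, 0 < r -> z r T = 0 /\ pderiv 0 1 z r T = 0 &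
      forall s : R, exists K : R, forall (i j : nat) (r t : R),
        (i + j <= 1)%N -> 0 < r <= 1 -> `|t| <= s ->
        `|pderiv i j z r t| <= K * r `^ (1 - (i + j)%:R - m_par R n)].

(** [w] is the Duhamel integral of [G] with initial time -oo
    ([B := ninfty_nbhs R], the retarded one) or +oo ([B := pinfty_nbhs R], the
    advanced one): the limit, as [T] tends to that end, of the Duhamel integrals
    with initial time [T], the first-order derivatives converging as well. *)
Definition duhamel (R : realType) (n : nat) (B : set_system R)
    (G w : R -> R -> R) : Prop :=
  exists z : R -> R -> R -> R,
    (forall T : R, zero_data_sol n G T (z T)) /\
    forall (i j : nat) (r t : R), (i + j <= 1)%N -> 0 < r ->
      (fun T : R => pderiv i j (z T) r t) @ B --> pderiv i j w r t.

(** ** The three solutions *)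

(** The free solution u_0^- with Cauchy data (phi, psi) at t = 0.  Its decay
    estimate is available for the exponents between (n-1)/2 and n-1 only, so it
    is stated for those not exceeding the decay rate [k] of the data. *)
Definition free_solution_with_data (R : realType) (n : nat) (k eps : R)
    (phi psi : R -> R) (u0 : R -> R -> R) : Prop :=
  [/\ wave_sol n (fun _ _ => 0) u0,
      forall r : R, 0 < r -> u0 r 0 = phi r /\ pderiv 0 1 u0 r 0 = psi r &
      forall l : R, (n%:R - 1) / 2 < l -> l < n%:R - 1 -> l <= k ->
        exists C0 : R, forall (j : nat) (r t : R), (j <= 1)%N -> 0 < r ->
          `|pderiv j 0 u0 r t| + `|pderiv 0 j u0 r t| <=
            C0 * eps * r `^ (1 - m_par R n - j%:R) * jap r `^ (j%:R - 1)
               * (weight n l r `|t|)^-1].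

Definition source (R : realType) (F V : R -> R) (u : R -> R -> R) (r t : R) : R :=
  F (u r t) - V r * u r t.

(** The solution u of the nonlinear equation attached to u_0^-.  The equation,
    the membership in X and the estimates do not single it out: the same weight
    bounds u, u_0^- and u - u_0^-, so the solution attached to another nonzero
    free solution satisfies them too.  What ties u to u_0^- is the integral
    equation
      u = u_0^- + (Duhamel integral of F(u) - V u from -oo to t),
    which is the last clause. *)
Definition nonlinear_solution (R : realType) (n : nat) (k : R) (F V : R -> R)
    (u0 u : R -> R -> R) : Prop :=
  let w := fun r t => u r t - u0 r t in
  [/\ in_X n k u,
      wave_sol n (source F V u) u,
      exists C : R, D_bound n k (C * fine (normX n k u)) w,
      (normX n k u <= 1)%E &
      duhamel n (ninfty_nbhs R) (source F V u) w].

(** The free solution u_0^+ attached to u, similarly determined by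
      u = u_0^+ + (Duhamel integral of F(u) - V u from +oo to t). *)
Definition scattered_free_solution (R : realType) (n : nat) (k : R)
    (F V : R -> R) (u u0 : R -> R -> R) : Prop :=
  let w := fun r t => u r t - u0 r t in
  [/\ in_X n k u0,
      wave_sol n (fun _ _ => 0) u0,
      exists C : R, D_bound n k (C * fine (normX n k u)) w &
      duhamel n (pinfty_nbhs R) (source F V u) w].

(** ** Energy norm *)

(** An extended real, so that an upper bound includes finiteness. *)
Definition energy_norm (R : realType) (n : nat) (w : R -> R -> R) (t : R)
    : \bar R :=
  poweR (\int[@lebesgue_measure R]_(r in `]0%R, +oo[)
           ((`|pderiv 1 0 w r t| ^+ 2 + `|pderiv 0 1 w r t| ^+ 2)
            * r ^+ n.-1)%:E)%E 2^-1.

(* Main.v *)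
(** Let [z] be one of the finite-time Duhamel integrals with source
    [G = F(u) - V u] that define [w = u - u_0^-] (or [u - u_0^+]).  Testing the
    weak equation with [chi * (z(r,t+h) - z(r,t-h)) / (2h)], which is C^1 because
    [z] is, and letting [h] tend to 0 gives the energy identity for [z] weighted
    by [chi].  With [chi] supported in a truncated light cone, and cut off near
    [r = 0] where the flux [r^(n-1) z_r z_t = O(r^(2a))] disappears in the limit,
    this yields [|z(t)|_e <= C * int_T^t |G(s)|_2 ds] up to small errors.  The
    weighted bound on [u] gives [|G(s)|_2 <= C <s>^(-1-theta)], whose integral is
    [O(<t>^(-theta))] uniformly in [T], and Fatou's lemma carries the bound over
    to [w]. *)

Require Import Defs.
From mathcomp Require Import measurable_realfun ring lra.

Set Implicit Arguments.
Unset Strict Implicit.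
Unset Printing Implicit Defensive.

Import Order.TTheory GRing.Theory Num.Theory.
Import numFieldNormedType.Exports.
Local Open Scope classical_set_scope.
Local Open Scope ring_scope.

(** * Integrals over segments *)

Section OneVariable.
Context {R : realType}.
Implicit Types (f g : R -> R) (a b c d : R).
Local Notation mu := (@lebesgue_measure R).

(** Two obstacles shape the proof. Since [z] is only C^1, its energy cannot be differentiated under
    the integral sign. The weak equation yields an identity integrated against functions of t; as
    the weighted energy and its expected rate are both continuous in t, the du Bois-Reymond lemma
    turns it into a genuine derivative. Secondly, the bound on [z] near r = 0 has a constant
    depending on the time interval, hence on T. It enters only through the flux error, a multiple of
    the inner radius, and that radius is chosen after T, so the final estimate stays uniform. The
    rate of the source comes from two places. Near the cone r = |t| the L^2 norm of F(u) behaves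
    like <t>^(-(a+m)(p-1)); well inside the cone V u decays only like <t>^(m-k). The bound p < 1 +
    4/(n-1) makes (a+m)(p-1) < 2 < kappa, so the decay of V costs nothing more, and keeps |F(u)|^2
    r^(n-1) integrable at r = 0. *)

Lemma within_itv_continuous f a b :
  (forall x, a <= x <= b -> {for x, continuous f}) ->
  {within `[a, b], continuous f}.
Proof.
by move=> cf; apply: continuous_in_subspaceT => x; rewrite inE/= in_itv/= => /cf.
Qed.

Lemma continuous_itv_integrable f a b :
  (forall x, a <= x <= b -> {for x, continuous f}) ->
  mu.-integrable `[a, b] (EFin \o f).
Proof.
move=> cf; apply: continuous_compact_integrable; first exact: segment_compact.
exact: within_itv_continuous.
Qed.

Lemma continuous_itv_measurable f a b :
  (forall x, a <= x <= b -> {for x, continuous f}) ->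
  measurable_fun `[a, b] f.
Proof.
move=> cf; apply: measurable_realfun.subspace_continuous_measurable_fun; first exact: measurable_itv.
exact: within_itv_continuous.
Qed.

Lemma Rintegral_segment_bound f a b (M : R) : a <= b ->
  (forall x, a <= x <= b -> {for x, continuous f}) ->
  (forall x, a <= x <= b -> `|f x| <= M) ->
  `|\int[mu]_(x in `[a, b]) f x| <= M * (b - a).
Proof.
move=> ab cf fM; have If := continuous_itv_integrable cf.
apply: le_trans (le_normr_Rintegral _ If) _ => //.
have -> : M * (b - a) = \int[mu]_(x in `[a, b]) M.
  rewrite Rintegral_cst//= lebesgue_measure_itv/= lte_fin.
  case: ifPn => // ba; have -> : a = b by lra.
  by rewrite subrr !mulr0.
apply: le_Rintegral => //.
- apply: (@continuous_itv_integrable (fun x => `|f x|)) => x xab.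
  by apply: continuous_comp; [exact: cf|exact: norm_continuous].
- by apply: (@continuous_itv_integrable (cst M)) => x _; exact: cst_continuous.
Qed.

Lemma Rintegral_FTC2 (f F : R -> R) a b : a <= b ->
  (forall x, a <= x <= b -> {for x, continuous f}) ->
  (forall x, a <= x <= b -> is_derive x 1 F (f x)) ->
  \int[mu]_(x in `[a, b]) f x = F b - F a.
Proof.
rewrite le_eqVlt => /predU1P[<- _ _|ab cf dF].
  by rewrite subrr set_itv1 Rintegral_set1.
have cF x : a <= x <= b -> {for x, continuous F}.
  move=> /dF dFx; apply: differentiable_continuous.
  by apply/derivable1_diffP; apply: ex_derive.
rewrite /Rintegral (@continuous_FTC2 _ f F)//.
- exact: within_itv_continuous.
- split.
  + move=> x; rewrite in_itv/= => /andP[ax xb].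
    by have := dF x; rewrite !ltW// => /(_ isT) ?; apply: ex_derive.
  + apply: cvg_at_right_filter; apply: cF; lra.
  + apply: cvg_at_left_filter; apply: cF; lra.
- move=> x; rewrite in_itv/= => /andP[ax xb].
  have := dF x; rewrite !ltW// => /(_ isT) ?.
  by rewrite derive1E derive_val.
Qed.

Lemma Rintegral_dominated (f_ : nat -> R -> R) f a b (M : R) :
  (forall n, measurable_fun `[a, b] (f_ n)) ->
  measurable_fun `[a, b] f ->
  (forall n x, a <= x <= b -> `|f_ n x| <= M) ->
  (forall x, a <= x <= b -> f_ n x @[n --> \oo] --> f x) ->
  \int[mu]_(x in `[a, b]) f_ n x @[n --> \oo] --> \int[mu]_(x in `[a, b]) f x.
Proof.
move=> mf_ mf fM ff.
have H1 n : measurable_fun `[a, b] (fun x => (f_ n x)%:E) by apply/measurable_EFinP.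
have H2 : measurable_fun `[a, b] (fun x => (f x)%:E) by apply/measurable_EFinP.
have H3 : {ae mu, forall x, `[a, b]%classic x ->
    (f_ n x)%:E @[n --> \oo] --> (f x)%:E}.
  apply/aeW => x; rewrite /= in_itv/= => xab; apply: cvg_EFin; last exact: ff.
  exact: nearW.
have H4 : mu.-integrable `[a, b] (EFin \o cst M).
  by apply: continuous_itv_integrable => x _; exact: cst_continuous.
have H5 : {ae mu, forall x n, `[a, b]%classic x ->
    (`|(f_ n x)%:E| <= (EFin \o cst M) x)%E}.
  by apply/aeW => x n; rewrite /= in_itv/= => xab; rewrite lee_fin; apply: fM.
have [If _ h] := @dominated_convergence _ _ R mu _ (measurable_itv `[a, b]) _ _ _ H1 H2 H3 H4 H5.
apply: fine_cvg; rewrite fineK; first exact: h.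
exact: integrable_fin_num.
Qed.

End OneVariable.

(** * Continuity in Omega *)

Section HalfPlaneContinuity.
Context {R : realType}.
Implicit Types (f g u : R -> R -> R) (a b c d : R).
Local Notation mu := (@lebesgue_measure R).

Definition continuous_Omega f :=
  forall r t : R, 0 < r -> {for (r, t), continuous (fun z : R * R => f z.1 z.2)}.

Lemma near_fst_gt0 (r t : R) : 0 < r -> \forall z \near (r, t), 0 < z.1.
Proof.
move=> r0; have : (fst : R * R -> R) z @[z --> (r, t)] --> r by exact: cvg_fst.
by move/cvgr_gt; apply.
Qed.

Lemma continuous_Omega_eq f g : (forall r t, 0 < r -> f r t = g r t) ->
  continuous_Omega f -> continuous_Omega g.
Proof.
move=> fg cf r t r0; rewrite /prop_for /continuous_at /= -fg//.
apply: cvg_trans (cf r t r0); apply: near_eq_cvg.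
by near=> z; apply: fg; near: z; exact: near_fst_gt0.
Unshelve. all: by end_near. Qed.

Lemma continuous_OmegaD f g : continuous_Omega f -> continuous_Omega g ->
  continuous_Omega (fun r t => f r t + g r t).
Proof. by move=> cf cg r t r0; apply: continuousD; [exact: cf|exact: cg]. Qed.

Lemma continuous_OmegaB f g : continuous_Omega f -> continuous_Omega g ->
  continuous_Omega (fun r t => f r t - g r t).
Proof. by move=> cf cg r t r0; apply: continuousB; [exact: cf|exact: cg]. Qed.

Lemma continuous_OmegaM f g : continuous_Omega f -> continuous_Omega g ->
  continuous_Omega (fun r t => f r t * g r t).
Proof. by move=> cf cg r t r0; apply: continuousM; [exact: cf|exact: cg]. Qed.

Lemma continuous_Omega_fst (h : R -> R) : (forall r, 0 < r -> {for r, continuous h}) ->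
  continuous_Omega (fun r _ => h r).
Proof.
move=> ch r t r0; apply: (@continuous_comp _ _ _ (fst : R * R -> R) h).
  exact: cvg_fst.
exact: ch.
Qed.

Lemma continuous_Omega_snd (h : R -> R) : continuous h ->
  continuous_Omega (fun _ t => h t).
Proof.
move=> ch r t r0; apply: (@continuous_comp _ _ _ (snd : R * R -> R) h).
  exact: cvg_snd.
exact: ch.
Qed.

Lemma continuous_Omega_cst (k : R) : continuous_Omega (fun _ _ => k).
Proof. by move=> r t r0; exact: cst_continuous. Qed.

Lemma continuous_Omega_comp (h : R -> R) f : continuous h -> continuous_Omega f ->
  continuous_Omega (fun r t => h (f r t)).
Proof.
move=> ch cf r t r0.
by apply: (@continuous_comp _ _ _ (fun z : R * R => f z.1 z.2) h); [exact: cf|exact: ch].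
Qed.

Lemma continuous_Omega_shift f (h : R) : continuous_Omega f ->
  continuous_Omega (fun r t => f r (t + h)).
Proof.
move=> cf r t r0.
apply: (@continuous_comp _ _ _ (fun z : R * R => (z.1, z.2 + h))
  (fun z => f z.1 z.2)); last exact: cf.
apply: (@cvg_pair _ _ _ _ (nbhs r) (nbhs (t + h))); first exact: cvg_fst.
by apply: cvgD; [exact: cvg_snd|exact: cvg_cst].
Qed.

Lemma continuous_Omega_l f (r t : R) : continuous_Omega f -> 0 < r ->
  {for r, continuous (f^~ t)}.
Proof.
move=> cf r0; apply: (@continuous_comp _ _ _ (fun x : R => (x, t)) (fun z => f z.1 z.2)).
  by apply: (@cvg_pair _ _ _ _ (nbhs r) (nbhs t)); [exact: cvg_id|exact: cvg_cst].
exact: cf.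
Qed.

Lemma continuous_Omega_r f (r : R) : continuous_Omega f -> 0 < r ->
  continuous (f r).
Proof.
move=> cf r0 t; apply: (@continuous_comp _ _ _ (fun x : R => (r, x)) (fun z => f z.1 z.2)).
  by apply: (@cvg_pair _ _ _ _ (nbhs r) (nbhs t)); [exact: cvg_cst|exact: cvg_id].
exact: cf.
Qed.

Lemma continuous_Omega_bounded f c d a b : 0 < c -> continuous_Omega f ->
  exists2 M, 0 <= M &
    forall r t, c <= r <= d -> a <= t <= b -> `|f r t| <= M.
Proof.
move=> c0 cf; set K := `[c, d] `*` `[a, b].
have cK : compact ((fun z : R * R => f z.1 z.2) @` K).
  apply: continuous_compact.
    apply: continuous_in_subspaceT => -[r t]; rewrite inE/= => -[/=].
    rewrite in_itv/= => /andP[cr _] _; apply: cf; exact: lt_le_trans cr.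
  by apply: compact_setX; exact: segment_compact.
have [M [Mr HM]] := compact_bounded cK.
exists (`|M| + 1) => [|r t rcd tab]; first by rewrite addr_ge0.
apply: (HM (`|M| + 1)); first by rewrite (le_lt_trans (ler_norm _))// ltrDl.
by exists (r, t) => //; split; rewrite /= in_itv.
Qed.

Lemma continuous_Rintegral_Omega f c d : 0 < c -> continuous_Omega f ->
  continuous (fun t => \int[mu]_(r in `[c, d]) f r t).
Proof.
move=> c0 cf t.
have [M M0 HM] := continuous_Omega_bounded d (t - 1) (t + 1) c0 cf.
have cfl s r : c <= r <= d -> {for r, continuous (f^~ s)}.
  move=> /andP[cr _]; apply: continuous_Omega_l => //; exact: lt_le_trans cr.
apply: (@continuity_under_integral R _ _ mu (fun s r => f r s) `[c, d] _
   (t - 1) (t + 1) _ _ (cst M)).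
- exact: measurable_itv.
- by move=> s _; apply: continuous_itv_integrable; exact: cfl.
- apply/aeW => r; rewrite /= in_itv/= => /andP[cr _] s _.
  apply: continuous_Omega_r => //; exact: lt_le_trans cr.
- by apply: (@continuous_itv_integrable _ (cst M)) => x _; exact: cst_continuous.
- move=> s; rewrite /= in_itv/= => /andP[s1 s2]; apply/aeW => r; rewrite /= in_itv/= => rcd.
  by apply: HM => //; rewrite !ltW.
- by rewrite inE/= in_itv/=; apply/andP; split; lra.
Qed.

(** Kept as an iterated integral, in the order of [wave_sol], so that the two integrations never
    have to be exchanged. *)
Definition dint c d a b f : R :=
  \int[mu]_(t in `[a, b]) \int[mu]_(r in `[c, d]) f r t.

Section dint.
Variables (c d a b : R).
Hypothesis c0 : 0 < c.
Local Notation I := (dint c d a b).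

Let cl f (t r : R) : continuous_Omega f -> c <= r <= d -> {for r, continuous (f^~ t)}.
Proof.
move=> cf /andP[cr _]; apply: continuous_Omega_l => //; exact: lt_le_trans cr.
Qed.

Let it f : continuous_Omega f ->
  mu.-integrable `[a, b] (EFin \o (fun t => \int[mu]_(r in `[c, d]) f r t)).
Proof.
by move=> cf; apply: continuous_itv_integrable => t _; apply: continuous_Rintegral_Omega.
Qed.

Lemma dint_eq f g : (forall r t, c <= r <= d -> a <= t <= b -> f r t = g r t) ->
  I f = I g.
Proof.
move=> fg; apply: eq_Rintegral => t; rewrite inE/= in_itv/= => tab.
by apply: eq_Rintegral => r; rewrite inE/= in_itv/= => rcd; exact: fg.
Qed.

Lemma dintD f g : continuous_Omega f -> continuous_Omega g ->
  I (fun r t => f r t + g r t) = I f + I g.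
Proof.
move=> cf cg; rewrite /dint -RintegralD//; [|exact: it|exact: it].
apply: eq_Rintegral => t _; rewrite RintegralD//;
  by apply: continuous_itv_integrable => r; exact: cl.
Qed.

Lemma dintZ f (k : R) : continuous_Omega f ->
  I (fun r t => k * f r t) = k * I f.
Proof.
move=> cf; rewrite /dint -RintegralZl//; last exact: it.
apply: eq_Rintegral => t _; rewrite RintegralZl//;
  by apply: continuous_itv_integrable => r; exact: cl.
Qed.

Lemma dintB f g : continuous_Omega f -> continuous_Omega g ->
  I (fun r t => f r t - g r t) = I f - I g.
Proof.
move=> cf cg; rewrite /dint -RintegralB//; [|exact: it|exact: it].
apply: eq_Rintegral => t _; rewrite RintegralB//;
  by apply: continuous_itv_integrable => r; exact: cl.
Qed.

Lemma dint_dominated (f_ : nat -> R -> R -> R) f (M : R) : c <= d ->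
  (forall n, continuous_Omega (f_ n)) -> continuous_Omega f ->
  (forall n r t, c <= r <= d -> a <= t <= b -> `|f_ n r t| <= M) ->
  (forall r t, c <= r <= d -> a <= t <= b -> f_ n r t @[n --> \oo] --> f r t) ->
  I (f_ n) @[n --> \oo] --> I f.
Proof.
move=> cd cf_ cf fM ff; apply: (@Rintegral_dominated _ _ _ _ _ (M * (d - c))).
- by move=> n; apply: continuous_itv_measurable => t _; exact: continuous_Rintegral_Omega.
- by apply: continuous_itv_measurable => t _; exact: continuous_Rintegral_Omega.
- by move=> n t tab; apply: Rintegral_segment_bound => // r; [exact: cl|move=> ?; exact: fM].
- move=> t tab; apply: (@Rintegral_dominated _ _ _ _ _ M).
  + by move=> n; apply: continuous_itv_measurable => r; exact: cl.
  + by apply: continuous_itv_measurable => r; exact: cl.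
  + by move=> n r ?; exact: fM.
  + by move=> r ?; exact: ff.
Qed.

End dint.

End HalfPlaneContinuity.

(** * C^1 functions on Omega with explicit partial derivatives *)

Section PartialDerivatives.
Context {R : realType}.
Local Notation mu := (@lebesgue_measure R).

Lemma is_derive_continuous (f : R -> R) (x df : R) : is_derive x 1 f df -> {for x, continuous f}.
Proof.
move=> dF; apply: differentiable_continuous.
by apply/derivable1_diffP; apply: ex_derive.
Qed.

Lemma MVT_bound (f df : R -> R) (a b M : R) :
  (forall x, a <= x <= b -> is_derive x 1 f (df x)) ->
  (forall x, a <= x <= b -> `|df x| <= M) ->
  forall x y, a <= x <= b -> a <= y <= b -> `|f x - f y| <= M * `|x - y|.
Proof.
move=> dF bM.
have H x y : a <= x -> x <= y -> y <= b -> `|f y - f x| <= M * `|y - x|.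
  move=> ax xy yb.
  have [z||c] := @MVT_segment R f df x y xy.
  - by rewrite in_itv/= => /andP[xz zy]; apply: dF; lra.
  - by apply: within_itv_continuous => z zxy; apply: is_derive_continuous; apply: dF; lra.
  - rewrite in_itv/= => cxy ->; rewrite normrM ler_wpM2r//; apply: bM; lra.
move=> x y /andP[ax xb] /andP[ay yb]; case: (leP y x) => [/H|/ltW/H]; first exact.
by rewrite distrC (distrC x y); exact.
Qed.

(** The partials are parameters, so that products, differences and time shifts come with formulas
    for them; [C1_OmegaP] and [C1_partials_pderiv] translate from and to [pderiv]. *)
Record C1_partials (u ur ut : R -> R -> R) : Prop := C1Partials {
  C1_dr : forall r t : R, 0 < r -> is_derive r 1 (u^~ t) (ur r t);
  C1_dt : forall r t : R, 0 < r -> is_derive t 1 (u r) (ut r t);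
  C1_cr : continuous_Omega ur;
  C1_ct : continuous_Omega ut }.

(** Both partials are bounded on a compact rectangle around the point, so moving first in t and then
    in r shows that [u] is Lipschitz there. *)
Lemma C1_partials_continuous u ur ut : C1_partials u ur ut -> continuous_Omega u.
Proof.
move=> [dr dt cr ct] r t r0.
have h0 : 0 < r / 2 by lra.
have [M M0 HM] := continuous_Omega_bounded (r + 1) (t - 1) (t + 1) h0 cr.
have [N N0 HN] := continuous_Omega_bounded (r + 1) (t - 1) (t + 1) h0 ct.
pose g (z : R * R) := M * `|z.1 - r| + N * `|z.2 - t|.
have cg : g z @[z --> (r, t)] --> (0 : R).
  have -> : 0 = M * `|r - r| + N * `|t - t| :> R by rewrite !subrr normr0; lra.
  apply: cvgD; apply: cvgM; (try exact: cvg_cst); apply: cvg_norm;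
    apply: cvgB; (try exact: cvg_cst); [exact: cvg_fst|exact: cvg_snd].
apply/cvgrPdist_le => e e0; near=> z.
have z1 : r / 2 <= z.1 <= r + 1.
  have : `|r - z.1| <= Num.min (r / 2) 1.
    near: z; have : (fst : R * R -> R) z @[z --> (r, t)] --> r by exact: cvg_fst.
    by move/cvgrPdist_le; apply; rewrite lt_min h0 ltr01.
  by rewrite le_min !ler_norml => /andP[/andP[? ?] /andP[? ?]]; lra.
have z2 : t - 1 <= z.2 <= t + 1.
  have : `|t - z.2| <= 1.
    near: z; have : (snd : R * R -> R) z @[z --> (r, t)] --> t by exact: cvg_snd.
    by move/cvgrPdist_le; apply.
  by rewrite !ler_norml => /andP[? ?]; lra.
have -> : u r t - u z.1 z.2 = (u r t - u r z.2) + (u r z.2 - u z.1 z.2) by ring.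
apply: le_trans (ler_normD _ _) _.
have H1 : `|u r t - u r z.2| <= N * `|z.2 - t|.
  rewrite (distrC z.2); apply: (@MVT_bound (u r) (ut r) (t - 1) (t + 1)); [ | | lra |exact: z2].
    by move=> x _; exact: dt.
  by move=> x xt; apply: HN; lra.
have H2 : `|u r z.2 - u z.1 z.2| <= M * `|z.1 - r|.
  rewrite (distrC z.1); apply: (@MVT_bound (u^~ z.2) (ur^~ z.2) (r / 2) (r + 1)); [ | | lra |exact: z1].
    by move=> x xr; apply: dr; lra.
  by move=> x xt; apply: HM.
apply: (@le_trans _ _ (g z)); first by rewrite /g; lra.
near: z; move/cvgr0Pnorm_le : cg => /(_ e e0); apply: filterS => z; apply: le_trans.
exact: ler_norm.
Unshelve. all: by end_near. Qed.

Lemma C1_OmegaP u : C1_Omega u -> C1_partials u (pderiv 1 0 u) (pderiv 0 1 u).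
Proof.
move=> h; split.
- move=> r t r0; have [d1 _ _ _] := h r t r0.
  by rewrite /pderiv /= derive1E; exact: derivableP.
- move=> r t r0; have [_ d1 _ _] := h r t r0.
  by rewrite /pderiv /= derive1E; exact: derivableP.
- by move=> r t r0; have [] := h r t r0.
- by move=> r t r0; have [] := h r t r0.
Qed.

Lemma C1_partials_pderiv u ur ut r t : C1_partials u ur ut -> 0 < r ->
  pderiv 1 0 u r t = ur r t /\ pderiv 0 1 u r t = ut r t.
Proof.
move=> [dr dt _ _] r0; rewrite /pderiv /= !derive1E.
by have := dr r t r0; have := dt r t r0 => ? ?; rewrite !derive_val.
Qed.

Lemma C1_partials_Omega u ur ut : C1_partials u ur ut -> C1_Omega u.
Proof.
move=> h r t r0; have [dr dt cr ct] := h; split.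
- by have ? := dr r t r0; apply: ex_derive.
- by have ? := dt r t r0; apply: ex_derive.
- apply: (continuous_Omega_eq _ cr) r0 => x s x0.
  by have [->] := C1_partials_pderiv s h x0.
- apply: (continuous_Omega_eq _ ct) r0 => x s x0.
  by have [_ ->] := C1_partials_pderiv s h x0.
Qed.

Lemma C1_partialsM u ur ut v vr vt : C1_partials u ur ut -> C1_partials v vr vt ->
  C1_partials (fun r t => u r t * v r t) (fun r t => u r t * vr r t + v r t * ur r t)
    (fun r t => u r t * vt r t + v r t * ut r t).
Proof.
move=> hu hv; have cu := C1_partials_continuous hu; have cv := C1_partials_continuous hv.
move: hu hv => [dur dut cur cut] [dvr dvt cvr cvt]; split.
- by move=> r t r0; apply: is_deriveM; [exact: dur|exact: dvr].
- by move=> r t r0; apply: is_deriveM; [exact: dut|exact: dvt].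
- by apply: continuous_OmegaD; apply: continuous_OmegaM.
- by apply: continuous_OmegaD; apply: continuous_OmegaM.
Qed.

Lemma C1_partialsB u ur ut v vr vt : C1_partials u ur ut -> C1_partials v vr vt ->
  C1_partials (fun r t => u r t - v r t) (fun r t => ur r t - vr r t)
    (fun r t => ut r t - vt r t).
Proof.
move=> [dur dut cur cut] [dvr dvt cvr cvt]; split.
- by move=> r t r0; apply: is_deriveB; [exact: dur|exact: dvr].
- by move=> r t r0; apply: is_deriveB; [exact: dut|exact: dvt].
- exact: continuous_OmegaB.
- exact: continuous_OmegaB.
Qed.

Lemma C1_partialsZ u ur ut (k : R) : C1_partials u ur ut ->
  C1_partials (fun r t => k * u r t) (fun r t => k * ur r t) (fun r t => k * ut r t).
Proof.
move=> [dur dut cur cut]; split.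
- move=> r t r0; have ? := dur r t r0; exact: is_deriveZ.
- move=> r t r0; have ? := dut r t r0; exact: is_deriveZ.
- by apply: continuous_OmegaM => //; exact: continuous_Omega_cst.
- by apply: continuous_OmegaM => //; exact: continuous_Omega_cst.
Qed.

Lemma is_derive_shift (f : R -> R) (x h df : R) : is_derive (x + h) 1 f df ->
  is_derive x 1 (fun y => f (y + h)) df.
Proof.
move=> dF; rewrite -[df]mulr1.
apply: (@is_derive1_comp _ f (fun y => y + h)).
rewrite -[X in is_derive _ _ _ X]addr0; apply: is_deriveD.
Qed.

Lemma C1_partials_shift u ur ut (h : R) : C1_partials u ur ut ->
  C1_partials (fun r t => u r (t + h)) (fun r t => ur r (t + h)) (fun r t => ut r (t + h)).
Proof.
move=> [dur dut cur cut]; split.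
- by move=> r t r0; exact: dur.
- by move=> r t r0; apply: is_derive_shift; exact: dut.
- exact: continuous_Omega_shift.
- exact: continuous_Omega_shift.
Qed.

Lemma continuous_primitive (f : R -> R) (a : R) : continuous f ->
  forall x : R, a < x -> is_derive x 1 (fun y => \int[mu]_(t in `[a, y]) f t) (f x).
Proof.
move=> cf x ax.
have [ | | | | ] := @continuous_FTC1_closed R f a x (x + 1); [lra| |exact: ax|exact: cf|].
  by apply: continuous_itv_integrable => y _; exact: cf.
by move=> dF <-; rewrite derive1E; exact: derivableP.
Qed.

(** No change of variables: both sides are increments of one primitive, which is constant on either
    side of [-L, L], where the endpoints stay after a shift by at most 1. *)
Lemma Rintegral_shift (f : R -> R) (L h : R) : continuous f -> 0 <= L -> `|h| <= 1 ->
  (forall x, `|x| >= L -> f x = 0) ->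
  \int[mu]_(x in `[- (L + 1), L + 1]) f (x + h) = \int[mu]_(x in `[- (L + 1), L + 1]) f x.
Proof.
move=> cf L0; rewrite ler_norml => /andP[h1 h2] f0.
(* The base point lies strictly to the left of all shifted endpoints, which are in [-(L+2), L+2], so
   that [F] is differentiable at each of them. *)
pose F x := \int[mu]_(t in `[- (L + 3), x]) f t.
have dF (x : R) : - (L + 2) <= x <= L + 2 -> is_derive x 1 F (f x).
  by move=> /andP[? _]; apply: continuous_primitive => //; lra.
have -> : \int[mu]_(x in `[- (L + 1), L + 1]) f x = F (L + 1) - F (- (L + 1)).
  apply: Rintegral_FTC2; [by lra|by move=> x _; exact: cf|by move=> x ?; apply: dF; lra].
have -> : \int[mu]_(x in `[- (L + 1), L + 1]) f (x + h) =
    F (L + 1 + h) - F (- (L + 1) + h).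
  apply: (@Rintegral_FTC2 _ _ (fun x => F (x + h))); first by lra.
  - move=> x _; apply: continuous_comp; last exact: cf.
    by apply: cvgD; [exact: cvg_id|exact: cvg_cst].
  - by move=> x ?; apply: is_derive_shift; apply: dF; lra.
have HR x y : L <= x <= L + 2 -> L <= y <= L + 2 -> F x = F y.
  move=> xL yL; apply/eqP; rewrite -subr_eq0 -normr_le0 -(mul0r `|x - y|).
  apply: (@MVT_bound _ f L (L + 2)) => //.
    by move=> z ?; apply: dF; lra.
  by move=> z ?; rewrite f0 ?normr0// ger0_norm; lra.
have HL x y : - (L + 2) <= x <= - L -> - (L + 2) <= y <= - L -> F x = F y.
  move=> xL yL; apply/eqP; rewrite -subr_eq0 -normr_le0 -(mul0r `|x - y|).
  apply: (@MVT_bound _ f (- (L + 2)) (- L)) => //.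
    by move=> z ?; apply: dF; lra.
  by move=> z ?; rewrite f0 ?normr0// ler0_norm; lra.
by rewrite (HR (L + 1 + h) (L + 1)) ?(HL (- (L + 1) + h) (- (L + 1)))//; lra.
Qed.

End PartialDerivatives.

(** * Weak solutions and the energy identity *)

Section WeakForm.
Context {R : realType}.
Local Notation mu := (@lebesgue_measure R).

Lemma Rintegral_support (A B : set R) (f : R -> R) : B `<=` A ->
  (forall x, A x -> ~ B x -> f x = 0) ->
  \int[mu]_(x in A) f x = \int[mu]_(x in B) f x.
Proof.
move=> BA f0; rewrite Rintegral_mkcond [RHS]Rintegral_mkcond.
apply: eq_Rintegral => x _; rewrite /patch; have [/set_mem Ax|/negP Ax] := boolP (x \in A).
  by case: ifPn => //; rewrite notin_setE => /f0; apply.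
by case: ifPn => // /set_mem/BA/mem_set.
Qed.

Definition vanishes_off (c d L : R) (f : R -> R -> R) :=
  forall r t : R, 0 < r -> ~~ [&& c <= r, r <= d & `|t| <= L] -> f r t = 0.

Lemma Rintegral_Omega_dint (c d L : R) (f : R -> R -> R) : 0 < c -> vanishes_off c d L f ->
  \int[mu]_t \int[mu]_(r in `]0, +oo[) f r t = dint c d (- L) L f.
Proof.
move=> c0 f0.
transitivity (\int[mu]_(t in `[- L, L]) \int[mu]_(r in `]0, +oo[) f r t).
  apply: (@Rintegral_support setT `[- L, L] (fun t => \int[mu]_(r in `]0, +oo[) f r t)) => //.
  move=> t _ /=; rewrite in_itv/= => /negP; rewrite -ler_norml => tL.
  transitivity (\int[mu]_(r in set0) f r t); last exact: Rintegral_set0.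
  apply: Rintegral_support => //.
  by move=> r; rewrite /= in_itv/= andbT => r0 _; apply: f0 => //; rewrite (negbTE tL) !andbF.
apply: eq_Rintegral => t _; apply: Rintegral_support => r /=; rewrite !in_itv/= ?andbT.
  by move=> /andP[cr _]; exact: lt_le_trans cr.
by move=> r0 /negP rcd; apply: f0 => //; rewrite andbA (negbTE rcd).
Qed.

Lemma dint_widen (c d L L' : R) (f : R -> R -> R) : 0 < c -> vanishes_off c d L f -> L <= L' ->
  vanishes_off c d L' f.
Proof.
move=> c0 f0 LL r t r0 h; apply: f0 => //; apply: contra h => /and3P[-> -> /= /le_trans]; exact.
Qed.

(** The weak equation moved to a fixed box, where linearity, time shifts and dominated convergence
    are available for [dint]. *)
Lemma wave_sol_test n G z eta etar etat (c d L : R) : 0 < c -> wave_sol n G z ->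
  C1_partials eta etar etat ->
  vanishes_off c d L eta -> vanishes_off c d L etar -> vanishes_off c d L etat ->
  dint c d (- L) L (fun r t => (pderiv 1 0 z r t * etar r t - pderiv 0 1 z r t * etat r t)
     * r ^+ n.-1) =
  dint c d (- L) L (fun r t => G r t * eta r t * r ^+ n.-1).
Proof.
move=> c0 [_ W] he v0 vr vt.
have supp : compact_supp_Omega eta by exists c, d, L; split => // r t r0; exact: v0.
set f1 := fun r t => (pderiv 1 0 z r t * pderiv 1 0 eta r t
        - pderiv 0 1 z r t * pderiv 0 1 eta r t) * r ^+ n.-1.
set f2 := fun r t => G r t * eta r t * r ^+ n.-1.
have vf1 : vanishes_off c d L f1.
  move=> r t r0 h; rewrite /f1; have [-> ->] := C1_partials_pderiv t he r0.
  by rewrite (vr _ _ r0 h) (vt _ _ r0 h) !mulr0 subrr mul0r.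
have vf2 : vanishes_off c d L f2.
  by move=> r t r0 h; rewrite /f2 (v0 _ _ r0 h) mulr0 mul0r.
transitivity (dint c d (- L) L f1).
  apply: dint_eq => r t /andP[cr _] _; rewrite /f1.
  by have [-> ->] := C1_partials_pderiv t he (lt_le_trans c0 cr).
have E1 := Rintegral_Omega_dint c0 vf1; have E2 := Rintegral_Omega_dint c0 vf2.
have W1 : \int[mu]_t \int[mu]_(r in `]0, +oo[) f1 r t =
  \int[mu]_t \int[mu]_(r in `]0, +oo[) f2 r t := W eta (C1_partials_Omega he) supp.
apply: etrans (esym E1) _.
apply: etrans W1 _.
exact: E2.
Qed.

Lemma dint_shift (c d L h : R) (f : R -> R -> R) : 0 < c -> 0 <= L -> `|h| <= 1 ->
  continuous_Omega f -> (forall r t, 0 < r -> L <= `|t| -> f r t = 0) ->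
  dint c d (- (L + 1)) (L + 1) (fun r t => f r (t + h)) = dint c d (- (L + 1)) (L + 1) f.
Proof.
move=> c0 L0 h1 cf f0.
apply: (@Rintegral_shift _ (fun t => \int[mu]_(r in `[c, d]) f r t)) => //.
  exact: continuous_Rintegral_Omega.
move=> t tL; transitivity (\int[mu]_(r in set0) f r t); last exact: Rintegral_set0.
apply: Rintegral_support => //.
by move=> r; rewrite /= in_itv/= => /andP[cr _] _; apply: f0 => //; exact: lt_le_trans cr.
Qed.

Lemma cvg_difference_quotient (f : R -> R) (t df : R) (h : nat -> R) : is_derive t 1 f df ->
  (forall n, h n != 0) -> h n @[n --> \oo] --> 0 ->
  (h n)^-1 * (f (t + h n) - f t) @[n --> \oo] --> df.
Proof.
move=> dF hn0 h0; have := @ex_derive _ _ _ _ _ _ _ dF; rewrite /derivable => /cvg_ex[l Hl].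
have ldf : l = df.
  have := @derive_val _ _ _ _ _ _ _ dF; rewrite /derive => <-; apply/esym; exact: cvg_lim Hl.
rewrite ldf in Hl.
have : h n @[n --> \oo] --> 0^'.
  move=> A /= [e e0 Ae]; have := h0; move/cvgr0Pnorm_lt => /(_ e e0); apply: filterS => n hn.
  by apply: Ae; rewrite /ball_ /= ?sub0r ?normrN.
move=> hp; have := cvg_comp _ _ hp Hl; apply: cvg_trans; apply: near_eq_cvg; apply: nearW => n /=.
by rewrite /GRing.scale /= mulr1 (addrC t).
Qed.

End WeakForm.

Section EnergyIdentity.
Context {R : realType}.
Local Notation mu := (@lebesgue_measure R).

Lemma normrM_le (x y A B : R) : `|x| <= A -> `|y| <= B -> `|x * y| <= A * B.
Proof. by move=> xA yB; rewrite normrM; apply: ler_pM. Qed.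

Lemma normrD_le (x y A B : R) : `|x| <= A -> `|y| <= B -> `|x + y| <= A + B.
Proof. by move=> xA yB; apply: (le_trans (ler_normD _ _)); exact: lerD. Qed.

Lemma normrB_le (x y A B : R) : `|x| <= A -> `|y| <= B -> `|x - y| <= A + B.
Proof. by move=> xA yB; apply: normrD_le; rewrite ?normrN. Qed.

Lemma normr_sym_quotient_le (f df : R -> R) (a b B h t : R) :
  (forall x, a <= x <= b -> is_derive x 1 f (df x)) ->
  (forall x, a <= x <= b -> `|df x| <= B) -> 0 < h -> a <= t - h -> t + h <= b ->
  `|(2 * h)^-1 * (f (t + h) - f (t + - h))| <= B.
Proof.
move=> dF bdf h0 ath thb; rewrite normrM gtr0_norm; last by rewrite invr_gt0; lra.
rewrite mulrC ler_pdivrMr; last by lra.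
have -> : B * (2 * h) = B * `|(t + h) - (t + - h)|.
  by rewrite [X in `|X|](_ : _ = 2 * h) ?gtr0_norm; [|lra|ring].
by apply: (MVT_bound dF bdf); lra.
Qed.

Lemma normr_fwd_quotient_le (f df : R -> R) (a b B h t : R) :
  (forall x, a <= x <= b -> is_derive x 1 f (df x)) ->
  (forall x, a <= x <= b -> `|df x| <= B) -> 0 <= B -> 0 < h -> a <= t -> t + h <= b ->
  `|(2 * h)^-1 * (f (t + h) - f t)| <= B.
Proof.
move=> dF bdf B0 h0 ath thb; rewrite normrM gtr0_norm; last by rewrite invr_gt0; lra.
rewrite mulrC ler_pdivrMr; last by lra.
apply: (@le_trans _ _ (B * `|(t + h) - t|)); first by apply: (MVT_bound dF bdf); lra.
by rewrite (addrC t) addrK gtr0_norm// ler_wpM2l//; lra.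
Qed.

Lemma cvg_sym_quotient (f : R -> R) (t df : R) (h : nat -> R) : is_derive t 1 f df ->
  (forall n, 0 < h n) -> h n @[n --> \oo] --> 0 ->
  (2 * h n)^-1 * (f (t + h n) - f (t + - h n)) @[n --> \oo] --> df.
Proof.
move=> dF h0 hcvg; have hn0 k : h k != 0 by rewrite gt_eqF.
have Nh0 : - h k @[k --> \oo] --> (0 : R) by rewrite -oppr0; exact: cvgN hcvg.
have Nhn0 k : - h k != 0 by rewrite oppr_eq0.
have Q1 := cvg_difference_quotient dF hn0 hcvg.
have Q2 := cvg_difference_quotient dF Nhn0 Nh0.
have -> : df = 2^-1 * (df + df) by field.
rewrite (_ : (fun k => _) = (fun k => 2^-1 *
   ((h k)^-1 * (f (t + h k) - f t) + (- h k)^-1 * (f (t + - h k) - f t)))).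
  by apply: cvgM; [exact: cvg_cst|exact: cvgD].
by apply/funext => k; field.
Qed.

(** A one-sided increment over the step 2h of the centred quotient: this mismatch is the origin of
    the factor 1/2 in the energy density. *)
Lemma cvg_fwd_quotient (f : R -> R) (t df : R) (h : nat -> R) : is_derive t 1 f df ->
  (forall n, 0 < h n) -> h n @[n --> \oo] --> 0 ->
  (2 * h n)^-1 * (f (t + h n) - f t) @[n --> \oo] --> 2^-1 * df.
Proof.
move=> dF h0 hcvg; have hn0 k : h k != 0 by rewrite gt_eqF.
have Q1 := cvg_difference_quotient dF hn0 hcvg.
rewrite (_ : (fun k => _) = (fun k => 2^-1 * ((h k)^-1 * (f (t + h k) - f t)))).
  by apply: cvgM; [exact: cvg_cst|exact: Q1].
by apply/funext => k; field.
Qed.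

Lemma continuous_Omega_bounded_seq (s : seq (R -> R -> R)) (c d a b : R) : 0 < c ->
  (forall i, continuous_Omega (nth (fun _ _ => 0) s i)) ->
  exists2 B, 0 <= B & forall i r t, c <= r <= d -> a <= t <= b ->
    `|nth (fun _ _ => 0) s i r t| <= B.
Proof.
move=> c0; elim: s => [_|f s IH cs].
  by exists 0 => // i r t _ _; rewrite nth_nil normr0.
have [B1 B10 b1] := continuous_Omega_bounded d a b c0 (cs 0).
have [B2 B20 b2] := IH (fun i => cs i.+1).
exists (B1 + B2) => [|[|i] r t rcd tab]; first exact: addr_ge0.
  by apply: (le_trans (b1 r t rcd tab)); rewrite lerDl.
by apply: (le_trans (b2 i r t rcd tab)); rewrite lerDr.
Qed.

(** The dominating constant for the limit h -> 0 in the energy identity: five products of three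
    factors bounded by [B], times the volume weight. *)
Lemma energy_integrand_le (B zr zt zr' zt' q D chi chir chit G rho : R) :
  0 <= B -> `|zr| <= B -> `|zt| <= B -> `|zr'| <= B -> `|zt'| <= B -> `|q| <= B ->
  `|D| <= B -> `|chi| <= B -> `|chir| <= B -> `|chit| <= B -> `|G| <= B -> `|rho| <= B ->
  `|(- 1 * (zr * zr' * q) + zr * D * chir - (- 1 * (zt * zt' * q) + zt * D * chit)
   - G * chi * D) * rho| <= 5 * B ^+ 4.
Proof.
move=> B0 *; have -> : 5 * B ^+ 4 =
  (1 * (B * B * B) + B * B * B + (1 * (B * B * B) + B * B * B) + B * B * B) * B by ring.
have n1 : `|- 1 : R| <= 1 by rewrite normrN normr1.
apply: normrM_le => //; apply: normrB_le; last by do 2 apply: normrM_le => //.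
by apply: normrB_le; apply: normrD_le; do 3?[apply: normrM_le => //].
Qed.

(** The test function is [chi * D], with [D] the centred difference quotient of
    [z] in time; [symD] moves the quotient falling on the derivatives of [z] to
    [chi], by invariance of the integral under time shifts. *)
Lemma energy_identity n (G z chi chir chit : R -> R -> R) (c d L P : R) :
  0 < c -> c <= d -> 0 <= L -> L < P ->
  wave_sol n G z -> continuous_Omega G -> C1_partials chi chir chit ->
  vanishes_off c d L chi -> vanishes_off c d L chir -> vanishes_off c d L chit ->
  dint c d (- (P + 1)) (P + 1) (fun r t =>
    ((pderiv 1 0 z r t ^+ 2 + pderiv 0 1 z r t ^+ 2) / 2 * chit r t
     - pderiv 1 0 z r t * pderiv 0 1 z r t * chir r t
     + G r t * pderiv 0 1 z r t * chi r t) * r ^+ n.-1) = 0.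
Proof.
move=> c0 cd L0 LP W cG hchi v0 vr vt.
have hz := C1_OmegaP W.1.
set zr := pderiv 1 0 z in hz *; set zt := pderiv 0 1 z in hz *.
have cz := C1_partials_continuous hz; have cchi := C1_partials_continuous hchi.
have [dzr dzt czr czt] := hz; have [dchir dchit cchir cchit] := hchi.
have crho : continuous_Omega (fun r _ : R => r ^+ n.-1).
  by apply: continuous_Omega_fst => r _; exact: exprn_continuous.
pose h k : R := k.+1%:R^-1.
have h0 k : 0 < h k by rewrite invr_gt0.
have h1 k : h k <= 1 by rewrite invf_le1// ler1n.
have hcvg : h k @[k --> \oo] --> 0 by exact: cvg_harmonic.
pose D k (v : R -> R -> R) r t := (2 * h k)^-1 * (v r (t + h k) - v r (t + - h k)).
have cD k v : continuous_Omega v -> continuous_Omega (D k v).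
  move=> cv; apply: continuous_OmegaM; first exact: continuous_Omega_cst.
  by apply: continuous_OmegaB; exact: continuous_Omega_shift.
have hD k : C1_partials (D k z) (D k zr) (D k zt).
  by apply: C1_partialsZ; apply: C1_partialsB; exact: C1_partials_shift.
pose q k r t := (2 * h k)^-1 * (chi r (t + h k) - chi r t).
have cq k : continuous_Omega (q k).
  apply: continuous_OmegaM; first exact: continuous_Omega_cst.
  by apply: continuous_OmegaB => //; exact: continuous_Omega_shift.
pose S k (v : R -> R -> R) r t := - 1 * (v r t * v r (t + h k) * q k r t).
have cS k v : continuous_Omega v -> continuous_Omega (S k v).
  move=> cv; apply: continuous_OmegaM; first exact: continuous_Omega_cst.
  apply: continuous_OmegaM => //; apply: continuous_OmegaM => //.
  exact: continuous_Omega_shift.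
pose J := dint c d (- (P + 1)) (P + 1).
have symD k v : continuous_Omega v ->
    J (fun r t => v r t * (chi r t * D k v r t) * r ^+ n.-1) =
    J (fun r t => S k v r t * r ^+ n.-1).
  move=> cv.
  (* Here [v] is a derivative of [z], hence merely continuous. Shifting [f2] by h makes it contain
     the same product v(t) v(t+h) as [f1], so that only the increment of [chi] remains. *)
  pose f1 r t := v r t * chi r t * v r (t + h k) * r ^+ n.-1.
  pose f2 r t := v r t * chi r t * v r (t + - h k) * r ^+ n.-1.
  have cf1 : continuous_Omega f1.
    apply: continuous_OmegaM => //; apply: continuous_OmegaM.
      exact: continuous_OmegaM.
    exact: continuous_Omega_shift.
  have cf2 : continuous_Omega f2.
    apply: continuous_OmegaM => //; apply: continuous_OmegaM.
      exact: continuous_OmegaM.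
    exact: continuous_Omega_shift.
  (* [chi] is known to vanish only for |t| > L, while [dint_shift] asks for |t| >= P: hence the
     strict inequality L < P. *)
  have sh : J (fun r t => f2 r (t + h k)) = J f2.
    apply: dint_shift => //; first by lra.
      by rewrite gtr0_norm.
    move=> r t r0 Pt; rewrite /f2 v0 ?mulr0 ?mul0r//.
    by rewrite !negb_and -!ltNge (lt_le_trans LP Pt) !orbT.
  have csh : continuous_Omega (fun r t => f2 r (t + h k)) by exact: continuous_Omega_shift.
  transitivity ((2 * h k)^-1 * (J f1 - J f2)).
    transitivity (J (fun r t => (2 * h k)^-1 * (f1 r t - f2 r t))).
      by apply: dint_eq => r t _ _; rewrite /f1 /f2 /D; ring.
    apply: etrans (@dintZ R c d _ _ c0 _ _ (continuous_OmegaB cf1 cf2)) _.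
    by apply: congr1; exact: (@dintB R c d _ _ c0 _ _ cf1 cf2).
  rewrite -sh; apply/esym.
  transitivity (J (fun r t => (2 * h k)^-1 * (f1 r t - f2 r (t + h k)))).
    by apply: dint_eq => r t _ _; rewrite /f1 /f2 /S /q addrK; ring.
  apply: etrans (@dintZ R c d _ _ c0 _ _ (continuous_OmegaB cf1 csh)) _.
  by apply: congr1; exact: (@dintB R c d _ _ c0 _ _ cf1 csh).
have weak k : J (fun r t => (zr r t * (chi r t * D k zr r t + D k z r t * chir r t)
     - zt r t * (chi r t * D k zt r t + D k z r t * chit r t)) * r ^+ n.-1) =
    J (fun r t => G r t * (chi r t * D k z r t) * r ^+ n.-1).
  have w0 f : vanishes_off c d L f -> forall r t, 0 < r ->
      ~~ [&& c <= r, r <= d & `|t| <= P + 1] -> f r t = 0.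
    by move=> vf; apply: dint_widen vf _ => //; lra.
  apply: (@wave_sol_test _ n G z) => //; first exact: (C1_partialsM hchi (hD k)).
  - by move=> r t r0 hh; rewrite (w0 _ v0)// mul0r.
  - by move=> r t r0 hh; rewrite (w0 _ v0)// (w0 _ vr)// mul0r mulr0 addr0.
  - by move=> r t r0 hh; rewrite (w0 _ v0)// (w0 _ vt)// mul0r mulr0 addr0.
pose K k r t := (S k zr r t + zr r t * D k z r t * chir r t
   - (S k zt r t + zt r t * D k z r t * chit r t)
   - G r t * chi r t * D k z r t) * r ^+ n.-1.
have cfl (f g : R -> R -> R) : continuous_Omega f -> continuous_Omega g ->
    continuous_Omega (fun r t => f r t * g r t) by exact: continuous_OmegaM.
have cfr (f : R -> R -> R) : continuous_Omega f ->
    continuous_Omega (fun r t => f r t * r ^+ n.-1) by move=> ?; exact: continuous_OmegaM.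
have cDz k := cD k z cz.
have cK k : continuous_Omega (K k).
  exact: (cfr _ (continuous_OmegaB (continuous_OmegaB
    (continuous_OmegaD (cS k zr czr) (cfl _ _ (cfl _ _ czr (cDz k)) cchir))
    (continuous_OmegaD (cS k zt czt) (cfl _ _ (cfl _ _ czt (cDz k)) cchit)))
    (cfl _ _ (cfl _ _ cG cchi) (cDz k)))).
have K0 k : J (K k) = 0.
  pose a1 r t := zr r t * (chi r t * D k zr r t) * r ^+ n.-1.
  pose a2 r t := zr r t * D k z r t * chir r t * r ^+ n.-1.
  pose a3 r t := zt r t * (chi r t * D k zt r t) * r ^+ n.-1.
  pose a4 r t := zt r t * D k z r t * chit r t * r ^+ n.-1.
  pose a5 r t := G r t * (chi r t * D k z r t) * r ^+ n.-1.
  pose b1 r t := S k zr r t * r ^+ n.-1.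
  pose b3 r t := S k zt r t * r ^+ n.-1.
  have c1 : continuous_Omega a1 := cfr _ (cfl _ _ czr (cfl _ _ cchi (cD k _ czr))).
  have c2 : continuous_Omega a2 := cfr _ (cfl _ _ (cfl _ _ czr (cDz k)) cchir).
  have c3 : continuous_Omega a3 := cfr _ (cfl _ _ czt (cfl _ _ cchi (cD k _ czt))).
  have c4 : continuous_Omega a4 := cfr _ (cfl _ _ (cfl _ _ czt (cDz k)) cchit).
  have c5 : continuous_Omega a5 := cfr _ (cfl _ _ cG (cfl _ _ cchi (cDz k))).
  have d1 : continuous_Omega b1 := cfr _ (cS k _ czr).
  have d3 : continuous_Omega b3 := cfr _ (cS k _ czt).
  have s1 : J a1 = J b1 := symD k zr czr.
  have s3 : J a3 = J b3 := symD k zt czt.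
  have := weak k.
  have -> : J (fun r t => (zr r t * (chi r t * D k zr r t + D k z r t * chir r t)
     - zt r t * (chi r t * D k zt r t + D k z r t * chit r t)) * r ^+ n.-1) =
     J a1 + J a2 - (J a3 + J a4).
    transitivity (J (fun r t => a1 r t + a2 r t - (a3 r t + a4 r t))).
      by apply: dint_eq => r t _ _; rewrite /a1 /a2 /a3 /a4;
        move: (D k zr r t) (D k zt r t) (D k z r t) => *; ring.
    apply: etrans (@dintB R c d _ _ c0 _ _ (continuous_OmegaD c1 c2) (continuous_OmegaD c3 c4)) _.
    apply: congr2; first exact: (@dintD R c d _ _ c0 _ _ c1 c2).
    by apply: congr1; exact: (@dintD R c d _ _ c0 _ _ c3 c4).
  rewrite s1 s3 => E.
  have -> : J (K k) = J b1 + J a2 - (J b3 + J a4) - J a5.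
    transitivity (J (fun r t => b1 r t + a2 r t - (b3 r t + a4 r t) - a5 r t)).
      by apply: dint_eq => r t _ _; rewrite /K /b1 /a2 /b3 /a4 /a5;
        move: (S k zr r t) (S k zt r t) (D k z r t) => *; ring.
    have c12 := continuous_OmegaD d1 c2; have c34 := continuous_OmegaD d3 c4.
    apply: etrans (@dintB R c d _ _ c0 _ _ (continuous_OmegaB c12 c34) c5) _.
    apply: congr2; last by [].
    apply: etrans (@dintB R c d _ _ c0 _ _ c12 c34) _.
    apply: congr2; first exact: (@dintD R c d _ _ c0 _ _ d1 c2).
    by apply: congr1; exact: (@dintD R c d _ _ c0 _ _ d3 c4).
  by rewrite E subrr.
(* In the limit the [zr] part gives -1/2 zr^2 chit directly; the [zt] part gives +1/2 from the
   shifted term and -1 from the derivative of [chi], again -1/2 in total. *)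
pose Kl r t := (- 1) * (((zr r t ^+ 2 + zt r t ^+ 2) / 2 * chit r t
     - zr r t * zt r t * chir r t + G r t * zt r t * chi r t) * r ^+ n.-1).
have cKp : continuous_Omega (fun r t => ((zr r t ^+ 2 + zt r t ^+ 2) / 2 * chit r t
     - zr r t * zt r t * chir r t + G r t * zt r t * chi r t) * r ^+ n.-1).
  apply: (@cfr); apply: continuous_OmegaD; last by apply: (@cfl) => //; exact: (@cfl).
  apply: continuous_OmegaB; last by apply: (@cfl) => //; exact: (@cfl).
  apply: (@cfl) => //; apply: (@cfl); last exact: continuous_Omega_cst.
  by apply: continuous_OmegaD; exact: (@cfl).
have [B B0 HB] := @continuous_Omega_bounded_seq
  [:: zr; zt; chir; chit; chi; G; fun r _ => r ^+ n.-1] c d (- (P + 2)) (P + 2) c0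
  ltac:(move=> [|[|[|[|[|[|[|i]]]]]]] //=; rewrite nth_nil; exact: continuous_Omega_cst).
have P1 t : - (P + 1) <= t <= P + 1 -> - (P + 2) <= t <= P + 2 by clear; lra.
have P2 k t : - (P + 1) <= t <= P + 1 ->
    [/\ - (P + 2) <= t + h k <= P + 2, - (P + 2) <= t - h k & t + h k <= P + 2].
  by move: (h0 k) (h1 k); clear; split; lra.
have r0 r : c <= r <= d -> 0 < r by move=> /andP[+ _]; exact: lt_le_trans.
have Kcvg : J (K k) @[k --> \oo] --> J Kl.
  apply: (@dint_dominated _ _ _ _ _ c0 _ _ (5 * B ^+ 4)) => //.
  - by apply: continuous_OmegaM => //; exact: continuous_Omega_cst.
  - move=> k r t rcd tP; have [y1 y2 y3] := P2 k t tP; have tP2 := P1 _ tP.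
    have dzt' x (_ : - (P + 2) <= x <= P + 2) := dzt r x (r0 r rcd).
    have dchit' x (_ : - (P + 2) <= x <= P + 2) := dchit r x (r0 r rcd).
    apply: (energy_integrand_le B0 (HB 0%N _ _ rcd tP2) (HB 1%N _ _ rcd tP2) (HB 0%N _ _ rcd y1)
      (HB 1%N _ _ rcd y1) _ _ (HB 4%N _ _ rcd tP2) (HB 2%N _ _ rcd tP2)
      (HB 3%N _ _ rcd tP2) (HB 5%N _ _ rcd tP2) (HB 6%N _ _ rcd tP2)).
    + by apply: (normr_fwd_quotient_le dchit' _ B0 (h0 k) (proj1 (andP tP2)) y3) => x; exact: (HB 3%N).
    + by apply: (normr_sym_quotient_le dzt' _ (h0 k) y2 y3) => x; exact: (HB 1%N).
  - move=> r t rcd tP.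
    have cvD : D k z r t @[k --> \oo] --> zt r t.
      exact: (cvg_sym_quotient (dzt r t (r0 r rcd)) h0 hcvg).
    have cvq : q k r t @[k --> \oo] --> 2^-1 * chit r t.
      exact: (cvg_fwd_quotient (dchit r t (r0 r rcd)) h0 hcvg).
    have cvS v : continuous_Omega v -> S k v r t @[k --> \oo] -->
        - 1 * (v r t * v r t * (2^-1 * chit r t)).
      move=> cv; apply: cvgM; first exact: cvg_cst.
      apply: cvgM; last exact: cvq.
      apply: cvgM; first exact: cvg_cst.
      have cvr : {for (t + 0), continuous (v r)} by apply: continuous_Omega_r => //; exact: r0.
      rewrite -[X in _ --> v r X](addr0 t).
      apply: (cvg_comp (fun k => t + h k) (v r)); last exact: cvr.
      by apply: cvgD; [exact: cvg_cst|exact: hcvg].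
    have -> : Kl r t = (- 1 * (zr r t * zr r t * (2^-1 * chit r t)) + zr r t * zt r t * chir r t
      - (- 1 * (zt r t * zt r t * (2^-1 * chit r t)) + zt r t * zt r t * chit r t)
      - G r t * chi r t * zt r t) * r ^+ n.-1 by rewrite /Kl; field.
    apply: cvgM; last exact: cvg_cst.
    apply: cvgB; last by apply: cvgM; [exact: cvg_cst|exact: cvD].
    apply: cvgB; apply: cvgD; [exact: cvS| | exact: cvS|];
      by apply: cvgM; [|exact: cvg_cst]; apply: cvgM; [exact: cvg_cst|exact: cvD].
have : J Kl = 0.
  apply: (cvg_unique _ Kcvg) => //.
  by rewrite (_ : (fun k => J (K k)) = cst 0); [exact: cvg_cst|apply/funext => k; rewrite K0].
by rewrite /J dintZ// mulN1r => /eqP; rewrite oppr_eq0 => /eqP.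
Qed.

End EnergyIdentity.

(** * The du Bois-Reymond lemma *)

Section DuBoisReymond.
Context {R : realType}.
Local Notation mu := (@lebesgue_measure R).

(** The positive part max(x, 0), in a form whose continuity is that of the absolute value. *)
Definition ppart (x : R) : R := (x + `|x|) / 2.

Lemma ppart_ge0 x : 0 <= ppart x.
Proof. by rewrite /ppart; have := ler_norm (- x); rewrite normrN; lra. Qed.

Lemma ppart_id x : 0 <= x -> ppart x = x.
Proof. by move=> x0; rewrite /ppart ger0_norm//; field. Qed.

Lemma ppart_eq0 x : x <= 0 -> ppart x = 0.
Proof. by move=> x0; rewrite /ppart ler0_norm// subrr mul0r. Qed.

Lemma ppart_continuous : continuous ppart.
Proof.
move=> x; apply: cvgM; last exact: cvg_cst.
by apply: cvgD; [exact: cvg_id|exact: norm_continuous].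
Qed.

Lemma continuous_ppart_subr (a : R) : continuous (fun x => ppart (x - a)).
Proof.
move=> x; apply: (@continuous_comp _ _ _ (fun x => x - a) ppart); last exact: ppart_continuous.
by apply: cvgB; [exact: cvg_id|exact: cvg_cst].
Qed.

Lemma continuous_ppart_subl (a : R) : continuous (fun x => ppart (a - x)).
Proof.
move=> x; apply: (@continuous_comp _ _ _ (fun x => a - x) ppart); last exact: ppart_continuous.
by apply: cvgB; [exact: cvg_cst|exact: cvg_id].
Qed.

Lemma near_lt (x b : R) : x < b -> \forall y \near x, y < b.
Proof. by have := @cvgr_lt _ _ (nbhs x) _ id x (@cvg_id _ (nbhs x)) b; apply. Qed.

Lemma near_gt (x b : R) : b < x -> \forall y \near x, b < y.
Proof. by have := @cvgr_gt _ _ (nbhs x) _ id x (@cvg_id _ (nbhs x)) b; apply. Qed.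

Lemma is_derive_locally_cst (f : R -> R) (x c : R) :
  (\near x, f x = c) -> is_derive x 1 f 0.
Proof.
move=> fc; apply: (@near_eq_is_derive R R R (cst c)).
  by apply: filterS fc => y ->.
Qed.

(** Squaring removes the corner: at 0 the difference quotient is at most |h|. This provides C^1
    cutoffs without any smooth bump function. *)
Lemma is_derive_sqr_ppart (x : R) : is_derive x 1 (fun y => ppart y ^+ 2) (2 * ppart x).
Proof.
have [x0|x0|->] := ltrgtP x 0.
- rewrite ppart_eq0 ?mulr0; last exact: ltW.
  apply: (@is_derive_locally_cst _ _ 0); near=> y; rewrite ppart_eq0 ?expr0n//.
  by apply: ltW; near: y; exact: near_lt.
- rewrite ppart_id ?ltW//.
  apply: (@near_eq_is_derive R R R (fun y => y * y)).
    near=> y; rewrite ppart_id//; apply: ltW; near: y; exact: near_gt.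
  rewrite (_ : 2 * x = x *: 1 + x *: 1); last by rewrite /GRing.scale /= mulr1; ring.
  exact: is_deriveM.
- rewrite ppart_id// mulr0.
  have H : h^-1 *: (ppart (h *: 1 + 0) ^+ 2 - ppart 0 ^+ 2) @[h --> 0^'] --> (0 : R).
    apply/cvgr0Pnorm_le => e e0; near=> h.
    rewrite [h *: _]mulr1 addr0 [ppart 0]ppart_id// expr0n subr0 [X in `|X|]/GRing.scale /= normrM.
    have h0 : h != 0 by near: h; exact: nbhs_dnbhs_neq.
    have he : `|h| <= e.
      near: h; apply: nbhs_dnbhs; near=> h.
      have : `|0 - h| <= e by near: h; move/cvgrPdist_le : (@cvg_id _ (nbhs (0:R))); apply.
      by rewrite sub0r normrN.
    have ph : ppart h <= `|h|.
      by rewrite /ppart; have := ler_norm h; lra.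
    rewrite normfV ger0_norm ?sqr_ge0// mulrC ler_pdivrMr ?normr_gt0//.
    apply: (@le_trans _ _ (`|h| * `|h|)); last by rewrite ler_wpM2r.
    by rewrite expr2; apply: ler_pM => //; exact: ppart_ge0.
  apply: DeriveDef; first by apply/cvg_ex; exists 0.
  exact: (cvg_lim _ H).
Unshelve. all: by end_near. Qed.

Lemma Rintegral0 (f : R -> R) (A : set R) : (forall x, A x -> f x = 0) ->
  \int[mu]_(x in A) f x = 0.
Proof.
move=> f0; transitivity (\int[mu]_(x in set0) f x); last exact: Rintegral_set0.
by apply: Rintegral_support => // x Ax _; exact: f0.
Qed.

(** The zero mean is what brings the primitive back to 0 at b. It is based at a - 1 so that it is
    differentiable at a as well. *)
Lemma compact_primitive (f : R -> R) (a b : R) : a < b -> continuous f ->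
  (forall x, x <= a \/ b <= x -> f x = 0) -> \int[mu]_(x in `[a, b]) f x = 0 ->
  exists F : R -> R, (forall x : R, is_derive x 1 F (f x)) /\
    (forall x, x <= a \/ b <= x -> F x = 0).
Proof.
move=> ab cf f0 int0; pose F x := \int[mu]_(t in `[a - 1, x]) f t.
have FL x : x <= a -> F x = 0.
  move=> xa; apply: Rintegral0 => y; rewrite /= in_itv/= => /andP[_ yx].
  by apply: f0; left; lra.
have dF (x : R) : is_derive x 1 F (f x).
  case: (ltP (a - 1) x) => [ax|xa]; first exact: continuous_primitive.
  rewrite f0; last by left; lra.
  apply: (@is_derive_locally_cst _ _ 0); near=> y; apply: FL; apply: ltW.
  by near: y; apply: near_lt; lra.
have Fb : F b = 0.
  have := @Rintegral_FTC2 R f F a b (ltW ab) (fun x _ => cf x) (fun x _ => dF x).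
  by rewrite int0 (FL a)// subr0.
exists F; split => // x [/FL//|bx]; apply/eqP; rewrite -normr_le0.
have : `|F x - F b| <= 0 * `|x - b|.
  apply: (@MVT_bound _ F f b x); [|lra|lra].
  by move=> y /andP[yb _]; rewrite f0 ?normr0//; right.
by rewrite Fb subr0 mul0r.
Unshelve. all: by end_near. Qed.

(** A primitive of [f] is nondecreasing with equal values at a and b, hence constant in between, and
    its derivative [f] vanishes. *)
Lemma continuous_Rintegral_eq0 (f : R -> R) (a b : R) : a < b -> continuous f ->
  (forall x, 0 <= f x) -> \int[mu]_(x in `[a, b]) f x = 0 ->
  forall x, a < x < b -> f x = 0.
Proof.
move=> ab cf f0 int0 x /andP[ax xb].
pose F x := \int[mu]_(t in `[a - 1, x]) f t.
have dF (y : R) : a <= y -> is_derive y 1 F (f y) by move=> ay; apply: continuous_primitive => //; lra.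
have Fmono y z : a <= y -> y <= z -> F y <= F z.
  move=> ay yz; have [ | |u] := @MVT_segment R F f y z yz.
  - by move=> u; rewrite in_itv/= => /andP[yu _]; apply: dF; lra.
  - apply: within_itv_continuous => u /andP[yu _]; apply: (@is_derive_continuous _ _ _ (f u)).
    by apply: dF; lra.
  - by move=> _ E; rewrite -subr_ge0 E mulr_ge0// subr_ge0.
have Fab : F b = F a.
  apply/eqP; rewrite -subr_eq0 -int0; apply/eqP/esym.
  by apply: Rintegral_FTC2; [lra|move=> y _; exact: cf|move=> y /andP[ay _]; exact: dF].
have dFx0 : is_derive x 1 F 0.
  apply: (@is_derive_locally_cst _ _ (F a)); near=> y.
  have ay : a <= y by apply: ltW; near: y; exact: near_gt.
  have yb : y <= b by apply: ltW; near: y; exact: near_lt.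
  by apply: le_anti; apply/andP; split; [rewrite -Fab; exact: Fmono|exact: Fmono].
have dFx := dF x (ltW ax).
by rewrite -(@derive_val _ _ _ _ _ _ _ dFx) (@derive_val _ _ _ _ _ _ _ dFx0).
Unshelve. all: by end_near. Qed.

(** With [P] a primitive of [Q], the test function is the primitive of
    [(E - P - c) * w], where the constant [c] gives it compact support. *)
Lemma du_bois_reymond (E Q : R -> R) (a b : R) : a < b -> continuous E -> continuous Q ->
  (forall g g' : R -> R, (forall x : R, is_derive x 1 g (g' x)) -> continuous g' ->
    (forall x, x <= a \/ b <= x -> g x = 0) -> (forall x, x <= a \/ b <= x -> g' x = 0) ->
    \int[mu]_(x in `[a, b]) (g' x * E x + g x * Q x) = 0) ->
  forall x : R, a < x < b -> is_derive x 1 E (Q x).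
Proof.
move=> ab cE cQ H.
pose P x := \int[mu]_(t in `[a - 1, x]) Q t.
have dP (y : R) : a <= y -> is_derive y 1 P (Q y) by move=> ay; apply: continuous_primitive => //; lra.
(* Projection onto [a, b]. The primitive [P] is controlled only from a on, whereas the test function
   must have a derivative continuous on the whole line. *)
pose cl (x : R) := a + ppart (x - a) - ppart (x - b).
have cl1 x : a <= cl x.
  rewrite /cl; case: (leP x b) => xb.
    by rewrite [ppart (x - b)]ppart_eq0 ?subr_le0// subr0 lerDl ppart_ge0.
  by rewrite !ppart_id; lra.
have clid x : a <= x <= b -> cl x = x.
  by move=> /andP[ax xb]; rewrite /cl ppart_id ?ppart_eq0; lra.
have ccl : continuous cl.
  move=> x; apply: cvgB; last exact: continuous_ppart_subr.
  by apply: cvgD; [exact: cvg_cst|exact: continuous_ppart_subr].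
pose Dl x := E (cl x) - P (cl x).
have cD : continuous Dl.
  move=> x; apply: cvgB.
    by apply: (@continuous_comp _ _ _ cl E); [exact: ccl|exact: cE].
  apply: (@continuous_comp _ _ _ cl P); first exact: ccl.
  exact: is_derive_continuous (dP _ (cl1 x)).
(* A weight positive exactly inside (a, b); it makes the derivative of the test function vanish
   outside without losing information inside. *)
pose w x := ppart (x - a) * ppart (b - x).
have cw : continuous w.
  by move=> x; apply: cvgM; [exact: continuous_ppart_subr|exact: continuous_ppart_subl].
have w0 x : x <= a \/ b <= x -> w x = 0.
  by move=> [xa|bx]; rewrite /w; [rewrite (@ppart_eq0 (x - a)) ?mul0r|rewrite (@ppart_eq0 (b - x)) ?mulr0];
    rewrite ?subr_le0.
have w_ge0 x : 0 <= w x by rewrite mulr_ge0// ppart_ge0.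
have wpos x : a < x < b -> 0 < w x.
  by move=> /andP[ax xb]; rewrite /w !ppart_id ?mulr_gt0// ?subr_gt0// subr_ge0 ltW.
have iab (f : R -> R) : continuous f -> mu.-integrable `[a, b] (EFin \o f).
  by move=> cf; apply: continuous_itv_integrable => x _; exact: cf.
have mab : measurable (`[a, b] : set R) by exact: measurable_itv.
pose W := \int[mu]_(x in `[a, b]) w x.
have W0 : W != 0.
  apply/eqP => /(continuous_Rintegral_eq0 ab cw w_ge0) /(_ ((a + b) / 2)) h.
  by have := wpos ((a + b) / 2); rewrite h ?ltxx; [move=> /(_ ltac:(lra))|lra].
have cDw : continuous (fun x => Dl x * w x).
  by move=> x; apply: cvgM; [exact: cD|exact: cw].
pose c := (\int[mu]_(x in `[a, b]) (Dl x * w x)) / W.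
pose f x := (Dl x - c) * w x.
have cDc : continuous (fun x => Dl x - c).
  by move=> x; apply: cvgB; [exact: cD|exact: cvg_cst].
have cf : continuous f by move=> x; apply: cvgM; [exact: cDc|exact: cw].
have ccw : continuous (fun x => c * w x) by move=> x; apply: cvgM; [exact: cvg_cst|exact: cw].
have f0 x : x <= a \/ b <= x -> f x = 0 by move=> /w0; rewrite /f => ->; rewrite mulr0.
have intf : \int[mu]_(x in `[a, b]) f x = 0.
  transitivity (\int[mu]_(x in `[a, b]) (Dl x * w x - c * w x)).
    by apply: eq_Rintegral => x _; rewrite /f mulrBl.
  rewrite (@RintegralB _ _ R mu _ _ _ mab (iab _ cDw) (iab _ ccw)) (@RintegralZl _ _ R mu _ _ c mab (iab _ cw)).
  by rewrite -/W /c divfK ?subrr.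
have [g [dg g0]] := compact_primitive ab cf f0 intf.
have cg : continuous g by move=> x; exact: is_derive_continuous (dg x).
have HE := H g f dg cf g0 f0.
have dgP (x : R) : a <= x <= b -> is_derive x 1 (fun y => g y * P y) (g x * Q x + P x * f x).
  by move=> /andP[ax _]; apply: is_deriveM; exact: dP.
have cP x : a <= x <= b -> {for x, continuous P}.
  by move=> /andP[ax _]; exact: is_derive_continuous (dP x ax).
have cgQ : continuous (fun x => g x * Q x) by move=> x; apply: cvgM; [exact: cg|exact: cQ].
have cPf x : a <= x <= b -> {for x, continuous (fun x => P x * f x)}.
  by move=> xab; apply: cvgM; [exact: cP|exact: cf].
have HP : \int[mu]_(x in `[a, b]) (g x * Q x + P x * f x) = 0.
  rewrite (@Rintegral_FTC2 _ _ (fun y => g y * P y) a b (ltW ab) _ dgP).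
    by rewrite !g0; [rewrite !mul0r subrr|left|right].
  by move=> x xab; apply: cvgD; [exact: cgQ|exact: cPf].
have cfD : continuous (fun x => (Dl x - c) * f x).
  by move=> x; apply: cvgM; [exact: cDc|exact: cf].
have ccf : continuous (fun x => c * f x) by move=> x; apply: cvgM; [exact: cvg_cst|exact: cf].
have cfE : continuous (fun x => f x * E x + g x * Q x).
  by move=> x; apply: cvgD; [apply: cvgM; [exact: cf|exact: cE]|exact: cgQ].
have cQP x : a <= x <= b -> {for x, continuous (fun x => g x * Q x + P x * f x)}.
  by move=> xab; apply: cvgD; [exact: cgQ|exact: cPf].
(* Subtract the integral of (g P)' from the tested identity: the terms g Q cancel and (E - P) f is
   left; c f has zero mean. The integrand is (Dl - c)^2 w, so [Dl] equals c inside. *)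
have HD : \int[mu]_(x in `[a, b]) ((Dl x - c) * f x) = 0.
  have i1 := iab _ cfE; have i2 := continuous_itv_integrable cQP; have i3 := iab _ ccf.
  transitivity (\int[mu]_(x in `[a, b]) ((f x * E x + g x * Q x) -
      (g x * Q x + P x * f x) - c * f x)).
    apply: eq_Rintegral => x; rewrite inE/= in_itv/= => xab.
    by rewrite /Dl clid//; ring.
  have i12 : mu.-integrable `[a, b]
      (EFin \o (fun x => (f x * E x + g x * Q x) - (g x * Q x + P x * f x))).
    by apply: continuous_itv_integrable => x xab; apply: cvgB; [exact: cfE|exact: cQP].
  rewrite (@RintegralB _ _ R mu _ _ _ mab i12 i3).
  by rewrite (@RintegralB _ _ R mu _ _ _ mab i1 i2) HE HP (@RintegralZl _ _ R mu _ _ c mab (iab _ cf)) intf mulr0 !subr0.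
have f2_ge0 x : 0 <= (Dl x - c) * f x by rewrite /f mulrA mulr_ge0// -expr2 sqr_ge0.
have Dc x : a < x < b -> E x = P x + c.
  move=> xab; have := continuous_Rintegral_eq0 ab cfD f2_ge0 HD xab.
  rewrite /f mulrA => /eqP; rewrite mulf_eq0 (gt_eqF (wpos x xab)) orbF -expr2 sqrf_eq0.
  by rewrite /Dl clid ?subr_eq0; [move=> /eqP <-; ring|lra].
move=> x xab; apply: (@near_eq_is_derive R R R (fun y => P y + c)).
  near=> y; apply/esym/Dc; apply/andP; split; near: y; [apply: near_gt|apply: near_lt];
    by case/andP: xab.
rewrite -[Q x]addr0; apply: is_deriveD; apply: dP; lra.
Unshelve. all: by end_near. Qed.

End DuBoisReymond.

(** * Energy inequality in a truncated cone *)

Section WeightedEnergy.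
Context {R : realType}.
Local Notation mu := (@lebesgue_measure R).

Definition energy_density (z : R -> R -> R) (r t : R) : R :=
  (pderiv 1 0 z r t ^+ 2 + pderiv 0 1 z r t ^+ 2) / 2.

(** Density of the time derivative of the energy weighted by [a], after the flux has been integrated
    by parts in r onto [a]. *)
Definition energy_rate (z G a ar at_ : R -> R -> R) (r t : R) : R :=
  energy_density z r t * at_ r t - pderiv 1 0 z r t * pderiv 0 1 z r t * ar r t
  + G r t * pderiv 0 1 z r t * a r t.

Lemma continuous_energy_density z : C1_Omega z -> continuous_Omega (energy_density z).
Proof.
move=> /C1_OmegaP [_ _ czr czt]; apply: continuous_OmegaM; last exact: continuous_Omega_cst.
by apply: continuous_OmegaD; apply: continuous_OmegaM.
Qed.

Lemma continuous_energy_rate z G a ar at_ : C1_Omega z -> continuous_Omega G ->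
  C1_partials a ar at_ -> continuous_Omega (energy_rate z G a ar at_).
Proof.
move=> cz cG ha; have ca := C1_partials_continuous ha; have ce := continuous_energy_density cz.
have [_ _ czr czt] := C1_OmegaP cz; have [_ _ car cat_] := ha.
apply: continuous_OmegaD; last by apply: continuous_OmegaM => //; exact: continuous_OmegaM.
apply: continuous_OmegaB; first exact: continuous_OmegaM.
by apply: continuous_OmegaM => //; exact: continuous_OmegaM.
Qed.

Lemma continuous_Omega_pow n : continuous_Omega (fun r _ : R => r ^+ n).
Proof. by apply: continuous_Omega_fst => r _; exact: exprn_continuous. Qed.

(** The energy identity for the weights g(t) a(r, t), with [g] supported in [-S, S], says that the
    rate is the weak time derivative of the weighted energy. *)
Lemma weighted_energy_derivative n (G z a ar at_ : R -> R -> R) (c d S : R) :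
  0 < c -> c <= d -> 0 < S ->
  wave_sol n G z -> continuous_Omega G -> C1_partials a ar at_ ->
  (forall r t, 0 < r -> `|t| <= S -> ~~ (c <= r <= d) ->
    [/\ a r t = 0, ar r t = 0 & at_ r t = 0]) ->
  forall s : R, - S < s < S ->
    is_derive s 1 (fun t => \int[mu]_(r in `[c, d]) (energy_density z r t * a r t * r ^+ n.-1))
      (\int[mu]_(r in `[c, d]) (energy_rate z G a ar at_ r s * r ^+ n.-1)).
Proof.
move=> c0 cd S0 W cG ha a0; have ca := C1_partials_continuous ha.
have cz := W.1; have ce := continuous_energy_density cz.
have cr := continuous_energy_rate cz cG ha.
have crho := @continuous_Omega_pow n.-1.
have ceR : continuous_Omega (fun r t => energy_density z r t * a r t * r ^+ n.-1).
  by apply: continuous_OmegaM => //; exact: continuous_OmegaM.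
have crR : continuous_Omega (fun r t => energy_rate z G a ar at_ r t * r ^+ n.-1).
  exact: continuous_OmegaM.
apply: du_bois_reymond; [lra|exact: continuous_Rintegral_Omega|exact: continuous_Rintegral_Omega|].
move=> g g' dg cg' g0 g'0; have cg : continuous g by move=> x; exact: is_derive_continuous (dg x).
have hg : C1_partials (fun _ t => g t) (fun _ _ => 0) (fun _ t => g' t).
  split.
  - by move=> r t _; exact: is_derive_cst.
  - by move=> r t _; exact: dg.
  - exact: continuous_Omega_cst.
  - exact: continuous_Omega_snd.
have off (t : R) : ~~ (`|t| <= S) -> t <= - S \/ S <= t.
  rewrite -ltNge lter_normr => /orP[|]; [right|left]; lra.
have va r t : 0 < r -> ~~ [&& c <= r, r <= d & `|t| <= S] ->
    (g t = 0 /\ g' t = 0) \/ [/\ a r t = 0, ar r t = 0 & at_ r t = 0].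
  move=> r0; rewrite andbA negb_and; case: (boolP (`|t| <= S)) => [tS|/off tS _].
    by rewrite orbF => rcd; right; exact: a0.
  by left; split; [exact: g0|exact: g'0].
have hga := C1_partialsM hg ha.
have v1 : vanishes_off c d S (fun r t => g t * a r t).
  by move=> r t r0 /(va r t r0) [[-> _]|[-> _ _]]; rewrite ?mul0r ?mulr0.
have v2 : vanishes_off c d S (fun r t => g t * ar r t + a r t * 0).
  by move=> r t r0 /(va r t r0) [[-> _]|[-> -> _]]; rewrite ?mul0r ?mulr0 ?addr0.
have v3 : vanishes_off c d S (fun r t => g t * at_ r t + a r t * g' t).
  by move=> r t r0 /(va r t r0) [[-> ->]|[-> _ ->]]; rewrite ?mul0r ?mulr0 ?addr0.
have SS : S < S + 1 by rewrite ltrDl.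
have E0 := energy_identity c0 cd (ltW S0) SS W cG hga v1 v2 v3.
pose h t := \int[mu]_(r in `[c, d]) (g' t * (energy_density z r t * a r t * r ^+ n.-1)
  + g t * (energy_rate z G a ar at_ r t * r ^+ n.-1)).
have hE t : h t = g' t * \int[mu]_(r in `[c, d]) (energy_density z r t * a r t * r ^+ n.-1)
    + g t * \int[mu]_(r in `[c, d]) (energy_rate z G a ar at_ r t * r ^+ n.-1).
  have mcd : measurable (`[c, d] : set R) by exact: measurable_itv.
  have cl f : continuous_Omega f -> mu.-integrable `[c, d] (EFin \o (f^~ t)).
    move=> cf; apply: continuous_itv_integrable => r /andP[cr1 _].
    by apply: continuous_Omega_l => //; exact: lt_le_trans cr1.
  have c1 : continuous_Omega (fun r t => g' t * (energy_density z r t * a r t * r ^+ n.-1)).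
    by apply: continuous_OmegaM => //; exact: continuous_Omega_snd.
  have c2 : continuous_Omega (fun r t => g t * (energy_rate z G a ar at_ r t * r ^+ n.-1)).
    by apply: continuous_OmegaM => //; exact: continuous_Omega_snd.
  apply: etrans (@RintegralD _ _ R mu _ _ _ mcd (cl _ c1) (cl _ c2)) _.
  apply: congr2; first exact: (@RintegralZl _ _ R mu _ _ _ mcd (cl _ ceR)).
  exact: (@RintegralZl _ _ R mu _ _ _ mcd (cl _ crR)).
transitivity (\int[mu]_(t in `[- S, S]) h t).
  by apply: eq_Rintegral => t _; rewrite hE.
transitivity (\int[mu]_(t in `[- (S + 1 + 1), S + 1 + 1]) h t).
  apply/esym; apply: Rintegral_support.
    by move=> t; rewrite /= !in_itv/= => /andP[? ?]; apply/andP; split; lra.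
  move=> t _ /=; rewrite in_itv/= => /negP; rewrite -ler_norml => /off tS.
  by rewrite hE g0// g'0// !mul0r addr0.
rewrite -[RHS]E0; apply: eq_Rintegral => t _; apply: eq_Rintegral => r _.
by rewrite /energy_rate /energy_density; ring.
Qed.

(** Squares of positive parts make the cutoffs C^1: [inner_cutoff dlt] goes from 0
    at [r = dlt] to 1 at [r = 2 * dlt], and [outer_cutoff rho] decreases to 0 at
    [x = rho] and tends to 1 as [rho] tends to infinity. *)
Definition inner_cutoff (dlt r : R) : R := 1 - ppart (1 - ppart ((r - dlt) / dlt) ^+ 2) ^+ 2.

Definition inner_cutoff' (dlt r : R) : R :=
  2 * ppart (1 - ppart ((r - dlt) / dlt) ^+ 2) * (2 * ppart ((r - dlt) / dlt) / dlt).

Definition outer_cutoff (rho x : R) : R := ppart ((rho - x) / rho) ^+ 2.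

Definition outer_cutoff' (rho x : R) : R := - (2 * ppart ((rho - x) / rho) / rho).

Lemma is_derive_affine (a b x : R) : is_derive x 1 (fun y => (y - a) / b) b^-1.
Proof.
rewrite (_ : (fun y => _) = (fun y : R => b^-1 * (y - a))); last by apply/funext => y; rewrite mulrC.
rewrite -[X in is_derive _ _ _ X]mulr1; apply: is_deriveZ.
rewrite -[X in is_derive _ _ _ X]subr0; apply: is_deriveB.
Qed.

Lemma is_derive_outer_cutoff (rho x : R) :
  is_derive x 1 (outer_cutoff rho) (outer_cutoff' rho x).
Proof.
have H : is_derive x 1 (fun y => (rho - y) / rho) (- rho^-1).
  rewrite (_ : (fun y => _) = (fun y => - ((y - rho) / rho))).
    by apply: is_deriveN; exact: is_derive_affine.
  by apply/funext => y; ring.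
have := @is_derive1_comp R (fun y => ppart y ^+ 2) _ x _ _ (is_derive_sqr_ppart _) H.
by rewrite /outer_cutoff' mulrN.
Qed.

Lemma is_derive_inner_cutoff (dlt x : R) :
  is_derive x 1 (inner_cutoff dlt) (inner_cutoff' dlt x).
Proof.
set y := (x - dlt) / dlt.
have H1 : is_derive x 1 (fun r => ppart ((r - dlt) / dlt) ^+ 2) (2 * ppart y * dlt^-1).
  exact: (@is_derive1_comp R (fun y => ppart y ^+ 2) _ x _ _ (is_derive_sqr_ppart _)
    (is_derive_affine dlt dlt x)).
have B (f : R -> R) df : is_derive x 1 f df -> is_derive x 1 (fun r => 1 - f r) (- df).
  by move=> ?; rewrite -[X in is_derive _ _ _ X]sub0r; apply: is_deriveB.
have H3 := @is_derive1_comp R (fun y => ppart y ^+ 2) _ x _ _ (is_derive_sqr_ppart _) (B _ _ H1).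
by have := B _ _ H3; rewrite /inner_cutoff' mulrN opprK.
Qed.

Lemma continuous_inner_cutoff' dlt : continuous (inner_cutoff' dlt).
Proof.
have H1 : continuous (fun r => ppart ((r - dlt) / dlt)).
  move=> x; apply: (@continuous_comp _ _ _ (fun r => (r - dlt) / dlt) ppart).
    exact: is_derive_continuous (is_derive_affine _ _ _).
  exact: ppart_continuous.
move=> x; apply: cvgM.
  apply: cvgM; first exact: cvg_cst.
  apply: (@continuous_comp _ _ _ (fun r => ppart ((r - dlt) / dlt) ^+ 2) (fun y => ppart (1 - y))).
    by apply: cvgM; exact: H1.
  exact: continuous_ppart_subl.
by apply: cvgM; [apply: cvgM; [exact: cvg_cst|exact: H1]|exact: cvg_cst].
Qed.

Lemma continuous_outer_cutoff' rho : continuous (outer_cutoff' rho).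
Proof.
move=> x; apply: cvgN; apply: cvgM; last exact: cvg_cst; apply: cvgM; first exact: cvg_cst.
apply: (@continuous_comp _ _ _ (fun r => (rho - r) / rho) ppart); last exact: ppart_continuous.
by apply: cvgM; [apply: cvgB; [exact: cvg_cst|exact: cvg_id]|exact: cvg_cst].
Qed.

Lemma inner_cutoff_bounds dlt r : 0 <= inner_cutoff dlt r <= 1.
Proof.
rewrite /inner_cutoff; set y := ppart (1 - _).
have y0 : 0 <= y by exact: ppart_ge0.
have y1 : y <= 1.
  rewrite /y; set u := (X in ppart X); have u1 : u <= 1 by rewrite /u gerBl sqr_ge0.
  by case: (leP 0 u) => [?|/ltW ?]; [rewrite ppart_id|rewrite ppart_eq0].
by nra.
Qed.

Lemma inner_cutoff_small dlt r : 0 < dlt -> r <= dlt ->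
  inner_cutoff dlt r = 0 /\ inner_cutoff' dlt r = 0.
Proof.
move=> d0 rd; rewrite /inner_cutoff /inner_cutoff' (@ppart_eq0 _ ((r - dlt) / dlt)); last first.
  by rewrite pmulr_lle0 ?invr_gt0// subr_le0.
by rewrite expr0n subr0 ppart_id// expr1n subrr mulr0 mul0r mulr0.
Qed.

Lemma inner_cutoff_large dlt r : 0 < dlt -> 2 * dlt <= r ->
  inner_cutoff dlt r = 1 /\ inner_cutoff' dlt r = 0.
Proof.
move=> d0 rd; rewrite /inner_cutoff /inner_cutoff' (@ppart_eq0 _ (1 - _)).
  by rewrite expr0n subr0 mulr0 mul0r.
have h : 1 <= (r - dlt) / dlt by rewrite ler_pdivlMr// mul1r; lra.
by rewrite ppart_id ?subr_le0 ?expr_ge1//; lra.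
Qed.

Lemma normr_inner_cutoff' dlt r : 0 < dlt -> r <= 2 * dlt -> `|inner_cutoff' dlt r| <= 4 / dlt.
Proof.
move=> d0 rd; rewrite /inner_cutoff'.
set y := ppart ((r - dlt) / dlt).
have y0 : 0 <= y by exact: ppart_ge0.
have y1 : y <= 1.
  rewrite /y; case: (leP 0 ((r - dlt) / dlt)) => [?|/ltW ?]; [rewrite ppart_id//|by rewrite ppart_eq0].
  by rewrite ler_pdivrMr// mul1r; lra.
have w1 : ppart (1 - y ^+ 2) <= 1.
  by rewrite ppart_id ?gerBl ?sqr_ge0// subr_ge0 expr_le1.
have w0 := ppart_ge0 (1 - y ^+ 2).
have di : 0 <= dlt^-1 by rewrite invr_ge0 ltW.
have p1 : 0 <= 2 * ppart (1 - y ^+ 2) * (2 * y).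
  by apply: mulr_ge0; apply: mulr_ge0.
rewrite mulrA ger0_norm; last exact: mulr_ge0.
by apply: ler_wpM2r => //; nra.
Qed.

Lemma outer_cutoff_ge0 rho x : 0 <= outer_cutoff rho x.
Proof. by rewrite /outer_cutoff sqr_ge0. Qed.

Lemma outer_cutoff_le1 rho x : 0 < rho -> 0 <= x -> outer_cutoff rho x <= 1.
Proof.
move=> p0 x0; rewrite /outer_cutoff expr_le1 ?ppart_ge0//.
case: (leP 0 ((rho - x) / rho)) => [?|/ltW ?]; [rewrite ppart_id//|by rewrite ppart_eq0].
by rewrite ler_pdivrMr// mul1r; lra.
Qed.

Lemma outer_cutoff'_le0 rho x : 0 < rho -> outer_cutoff' rho x <= 0.
Proof.
by move=> p0; rewrite /outer_cutoff' oppr_le0 mulr_ge0 ?invr_ge0 ?(ltW p0)// mulr_ge0// ppart_ge0.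
Qed.

Lemma outer_cutoff_large rho x : 0 < rho -> rho <= x ->
  outer_cutoff rho x = 0 /\ outer_cutoff' rho x = 0.
Proof.
move=> p0 px; rewrite /outer_cutoff /outer_cutoff' ppart_eq0; last first.
  by rewrite pmulr_lle0 ?invr_gt0// subr_le0.
by rewrite expr0n mulr0 mul0r oppr0.
Qed.

End WeightedEnergy.

Section EnergyInequality.
Context {R : realType}.
Local Notation mu := (@lebesgue_measure R).

(** At the time T + sg * tau the outer argument is r + tau, so the support shrinks at unit speed
    away from T, as a domain of dependence does. The factor 0 is left in the time derivative in the
    shape that [energy_rate_le] expects. *)
Lemma C1_partials_cone_cutoff (dlt rho sg T : R) :
  C1_partials (fun r t => inner_cutoff dlt r * outer_cutoff rho (r + sg * (t - T)))
    (fun r t => inner_cutoff dlt r * outer_cutoff' rho (r + sg * (t - T))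
      + outer_cutoff rho (r + sg * (t - T)) * inner_cutoff' dlt r)
    (fun r t => inner_cutoff dlt r * (outer_cutoff' rho (r + sg * (t - T)) * sg)
      + outer_cutoff rho (r + sg * (t - T)) * 0).
Proof.
have cx : continuous_Omega (fun r t => r + sg * (t - T)).
  apply: continuous_OmegaD.
    by apply: continuous_Omega_fst => r _; exact: cvg_id.
  apply: continuous_Omega_snd => t; apply: cvgM; first exact: cvg_cst.
  by apply: cvgB; [exact: cvg_id|exact: cvg_cst].
have cb' : continuous_Omega (fun r t => outer_cutoff' rho (r + sg * (t - T))).
  exact: (continuous_Omega_comp (@continuous_outer_cutoff' R rho) cx).
apply: (@C1_partialsM R (fun r _ => inner_cutoff dlt r) (fun r _ => inner_cutoff' dlt r) (fun _ _ => 0)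
  (fun r t => outer_cutoff rho (r + sg * (t - T)))
  (fun r t => outer_cutoff' rho (r + sg * (t - T)))
  (fun r t => outer_cutoff' rho (r + sg * (t - T)) * sg)); split.
- by move=> r t _; exact: is_derive_inner_cutoff.
- by move=> r t _; exact: is_derive_cst.
- by apply: continuous_Omega_fst => r _; exact: continuous_inner_cutoff'.
- exact: continuous_Omega_cst.
- by move=> r t _; apply: is_derive_shift; exact: is_derive_outer_cutoff.
- move=> r t _; apply: (@is_derive1_comp R (outer_cutoff rho) (fun t => r + sg * (t - T))).
    exact: is_derive_outer_cutoff.
  rewrite -[X in is_derive _ _ _ X]add0r; apply: is_deriveD.
  rewrite -[X in is_derive _ _ _ X]mulr1; apply: is_deriveZ.
  rewrite -[X in is_derive _ _ _ X]subr0; apply: is_deriveB.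
- exact: cb'.
- by apply: continuous_OmegaM => //; exact: continuous_Omega_cst.
Qed.

(** The outer cutoff travels with speed 1, so the terms with [be'] have a sign;
    only the flux through the inner cutoff and the source remain. *)
Lemma energy_rate_le (sg e zr zt al be al' be' G lam w : R) :
  (sg = 1 \/ sg = - 1) -> e = (zr ^+ 2 + zt ^+ 2) / 2 ->
  0 <= al <= 1 -> 0 <= be <= 1 -> be' <= 0 -> 0 < lam -> 0 <= w ->
  sg * ((e * (al * (be' * sg) + be * 0) - zr * zt * (al * be' + be * al')
    + G * zt * (al * be)) * w)
  <= `|zr * zt * w| * `|al'| * be + lam * (e * (al * be) * w) + (2 * lam)^-1 * (G ^+ 2 * w).
Proof.
move=> hsg -> /andP[al0 al1] /andP[be0 be1] be'0 lam0 w0.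
have ab0 : 0 <= al * be by exact: mulr_ge0.
have ab1 : al * be <= 1 by rewrite mulr_ile1.
have sq (x y : R) : x * y <= (x ^+ 2 + y ^+ 2) / 2.
  by have := sqr_ge0 (x - y); rewrite sqrrB; lra.
(* As sg^2 = 1, the bracket is al be' (e - sg zr zt), and |zr zt| <= e: the flux through the cone is
   dominated by the energy leaving with it. *)
have h1 : sg * ((zr ^+ 2 + zt ^+ 2) / 2 * (al * (be' * sg)) - zr * zt * (al * be')) * w <= 0.
  rewrite mulr_le0_ge0//.
  have -> : sg * ((zr ^+ 2 + zt ^+ 2) / 2 * (al * (be' * sg)) - zr * zt * (al * be')) =
      (al * be') * ((zr ^+ 2 + zt ^+ 2) / 2 - sg * zr * zt).
    by case: hsg => ->; field.
  apply: mulr_le0_ge0; first exact: mulr_ge0_le0.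
  rewrite subr_ge0; have := sq (sg * zr) zt; suff -> : (sg * zr) ^+ 2 = zr ^+ 2 by [].
  by case: hsg => ->; ring.
have h2 : - sg * (zr * zt * (be * al')) * w <= `|zr * zt * w| * `|al'| * be.
  apply: (le_trans (ler_norm _)).
  have -> : `|zr * zt * w| * `|al'| * be = `|zr * zt * w| * `|al'| * `|be|.
    by rewrite (ger0_norm be0).
  have -> : - sg * (zr * zt * (be * al')) * w = - sg * ((zr * zt * w) * al' * be) by ring.
  rewrite normrM normrN; suff -> : `|sg| = 1 by rewrite mul1r !normrM.
  by case: hsg => ->; rewrite ?normrN normr1.
have h3 : sg * (G * zt * (al * be)) * w <= lam * ((zr ^+ 2 + zt ^+ 2) / 2 * (al * be) * w)
    + (2 * lam)^-1 * (G ^+ 2 * w).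
  (* Young's inequality with a free weight [lam], which is later adapted to the current energy. *)
  have k1 : sg * G * zt <= lam * ((zr ^+ 2 + zt ^+ 2) / 2) + (2 * lam)^-1 * G ^+ 2.
    have -> : (2 * lam)^-1 * G ^+ 2 = lam * ((lam^-1 * sg * G) ^+ 2 / 2).
      have ln : lam != 0 by rewrite gt_eqF.
      by case: hsg => ->; field.
    rewrite -mulrDr.
    have -> : sg * G * zt = lam * ((lam^-1 * sg * G) * zt).
      by rewrite !mulrA mulfV ?mul1r// gt_eqF.
    rewrite ler_pM2l//; have := sq (lam^-1 * sg * G) zt; have := sqr_ge0 zr; lra.
  have k2 : 0 <= (2 * lam)^-1 * G ^+ 2 by rewrite mulr_ge0 ?sqr_ge0// invr_ge0; lra.
  have k3 := ler_wpM2r ab0 k1.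
  have k4 : (2 * lam)^-1 * G ^+ 2 * (al * be) <= (2 * lam)^-1 * G ^+ 2.
    by rewrite ler_piMr.
  have k5 : sg * G * zt * (al * be) <=
    lam * ((zr ^+ 2 + zt ^+ 2) / 2) * (al * be) + (2 * lam)^-1 * G ^+ 2 by lra.
  have := ler_wpM2r w0 k5; lra.
lra.
Qed.

Lemma integral_support (A B : set R) (f : R -> R) : B `<=` A ->
  (forall x, A x -> ~ B x -> f x = 0) ->
  (\int[mu]_(x in A) (f x)%:E = \int[mu]_(x in B) (f x)%:E)%E.
Proof.
move=> BA f0; rewrite integral_mkcond [RHS]integral_mkcond.
apply: eq_integral => x _; rewrite /patch; have [/set_mem Ax|/negP Ax] := boolP (x \in A).
  by case: ifPn => //; rewrite notin_setE => /f0 ->.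
by case: ifPn => // /set_mem/BA/mem_set.
Qed.

(** Times are [T + sg * tau]: [sg = 1] evolves forwards from [T], [sg = - 1]
    backwards. [N tau] bounds the L^2 norm of the source, [Phi] is a primitive
    of [N], and [eta] regularizes the square root of the energy. *)
Lemma energy_estimate n (G z : R -> R -> R) (T sg tau1 K eta rho : R) (N Phi : R -> R) :
  wave_sol n G z -> continuous_Omega G -> (sg = 1 \/ sg = - 1) -> 0 < tau1 ->
  (forall r, 0 < r -> pderiv 1 0 z r T = 0 /\ pderiv 0 1 z r T = 0) ->
  0 <= K ->
  (forall r t, 0 < r <= 1 -> `|t| <= `|T| + tau1 ->
     `|pderiv 1 0 z r t * pderiv 0 1 z r t * r ^+ n.-1| <= K * r) ->
  (forall tau, 0 <= tau <= tau1 -> 0 < N tau) ->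
  (forall tau : R, 0 <= tau <= tau1 -> is_derive tau 1 Phi (N tau)) ->
  (forall tau c d, 0 <= tau <= tau1 -> 0 < c -> c <= d ->
     \int[mu]_(r in `[c, d]) (G r (T + sg * tau) ^+ 2 * r ^+ n.-1) <= N tau ^+ 2) ->
  0 < eta -> 0 < rho ->
  exists2 dlt0, 0 < dlt0 & forall dlt, 0 < dlt <= dlt0 ->
    (\int[mu]_(r in `]0%R, +oo[) ((pderiv 1 0 z r (T + sg * tau1) ^+ 2
       + pderiv 0 1 z r (T + sg * tau1) ^+ 2)
       * (inner_cutoff dlt r * outer_cutoff rho (r + tau1)) * r ^+ n.-1)%:E
     <= (2 * (2 * eta + (Phi tau1 - Phi 0)) ^+ 2)%:E)%E.
Proof.
move=> W cG hsg tau0 z0 K0 hK N0 dPhi hN eta0 rho0.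
have Kt : 0 < 4 * K * tau1 + 1 by have := mulr_ge0 K0 (ltW tau0); lra.
(* The bound 1/2 keeps [dlt, 2 dlt] inside (0, 1], where the flux hypothesis applies; the other one
   makes the accumulated flux error 4 K dlt tau1 / eta at most eta. The summand 1 avoids a division
   by 0. *)
exists (Num.min (1 / 2) (eta ^+ 2 / (4 * K * tau1 + 1))).
  rewrite lt_min; apply/andP; split; first by lra.
  by rewrite divr_gt0// exprn_gt0.
move=> dlt /andP[dlt0]; rewrite le_min => /andP[dlt1]; rewrite ler_pdivlMr// => dlt2.
set a := fun r t => inner_cutoff dlt r * outer_cutoff rho (r + sg * (t - T)).
have ha := C1_partials_cone_cutoff dlt rho sg T; rewrite -/a in ha.
set ar := (X in C1_partials a X _) in ha; set at_ := (X in C1_partials a _ X) in ha.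
(* S exceeds every time met, so that two-sided derivatives exist at both ends; beyond r = d the
   outer cutoff vanishes for all |t| <= S. *)
pose S := `|T| + tau1 + 1; pose d := rho + S + `|T| + 1.
have T0 : 0 <= `|T| by [].
have S0 : 0 < S by rewrite /S; clear -T0 tau0; lra.
have dd : dlt <= d by rewrite /d /S; clear -T0 tau0 rho0 dlt1; lra.
have sgn : `|sg| = 1 by case: hsg => ->; rewrite ?normrN normr1.
have sgsg : sg * sg = 1 by case: hsg => ->; rewrite ?mulrNN mulr1.
have va r t : 0 < r -> `|t| <= S -> ~~ (dlt <= r <= d) ->
    [/\ a r t = 0, ar r t = 0 & at_ r t = 0].
  move=> r0 tS; rewrite negb_and -!ltNge => /orP[rd|dr].
    have [i1 i2] := inner_cutoff_small dlt0 (ltW rd).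
    by rewrite /a /ar /at_ i1 i2 !mul0r !mulr0 !addr0.
  have rx : rho <= r + sg * (t - T).
    have h1 : `|sg * (t - T)| <= S + `|T|.
      by rewrite normrM sgn mul1r; apply: (le_trans (ler_normB _ _)); rewrite lerD2r.
    have := ler_norm (- (sg * (t - T))); rewrite normrN.
    by move: h1 dr; rewrite /d; clear; lra.
  have [i1 i2] := outer_cutoff_large rho0 rx.
  by rewrite /a /ar /at_ i1 i2 !mul0r !mulr0 !addr0.
have dE := weighted_energy_derivative dlt0 dd S0 W cG ha va.
set En := fun t => \int[mu]_(r in `[dlt, d]) (energy_density z r t * a r t * r ^+ n.-1) in dE.
set Q := fun t => \int[mu]_(r in `[dlt, d]) (energy_rate z G a ar at_ r t * r ^+ n.-1) in dE.
have {}dE t : - S < t < S -> is_derive t 1 En (Q t) := @dE t.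
have rpos r : dlt <= r <= d -> 0 < r by move=> /andP[+ _]; exact: lt_le_trans.
have st tau : 0 <= tau <= tau1 -> `|T + sg * tau| <= `|T| + tau1.
  move=> /andP[t0 t1]; apply: (le_trans (ler_normD _ _)); rewrite lerD2l.
  by rewrite normrM sgn mul1r ger0_norm.
have xtau r tau : r + sg * ((T + sg * tau) - T) = r + tau.
  by rewrite addrAC subrr add0r mulrA sgsg mul1r.
have mcd : measurable (`[dlt, d] : set R) by exact: measurable_itv.
have int (f : R -> R -> R) t : continuous_Omega f -> mu.-integrable `[dlt, d] (EFin \o (f^~ t)).
  move=> cf; apply: continuous_itv_integrable => r /rpos; exact: continuous_Omega_l.
have cz := W.1; have ce := continuous_energy_density cz.
have [_ _ czr czt] := C1_OmegaP cz.
have ca := C1_partials_continuous ha.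
have crho := @continuous_Omega_pow R n.-1.
have cEa : continuous_Omega (fun r t => energy_density z r t * a r t * r ^+ n.-1).
  by apply: continuous_OmegaM => //; exact: continuous_OmegaM.
have En0 t : 0 <= En t.
  apply: Rintegral_ge0 => r; rewrite /= in_itv/= => /rpos r0.
  apply: mulr_ge0; last exact: exprn_ge0 (ltW r0).
  apply: mulr_ge0; first by rewrite /energy_density divr_ge0// addr_ge0 ?sqr_ge0.
  by apply: mulr_ge0; [case/andP: (inner_cutoff_bounds dlt r)|exact: outer_cutoff_ge0].
have flux tau : 0 <= tau <= tau1 -> \int[mu]_(r in `[dlt, d])
    (`|pderiv 1 0 z r (T + sg * tau) * pderiv 0 1 z r (T + sg * tau) * r ^+ n.-1|
      * `|inner_cutoff' dlt r| * outer_cutoff rho (r + tau)) <= 8 * K * dlt.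
  move=> htau.
  have cb : continuous_Omega (fun r _ : R => outer_cutoff rho (r + tau)).
    apply: continuous_Omega_fst => r _.
    exact: is_derive_continuous (is_derive_shift (is_derive_outer_cutoff rho (r + tau))).
  have cf : continuous_Omega (fun r t => `|pderiv 1 0 z r t * pderiv 0 1 z r t * r ^+ n.-1|
      * `|inner_cutoff' dlt r| * outer_cutoff rho (r + tau)).
    apply: continuous_OmegaM => //; apply: continuous_OmegaM.
      apply: (continuous_Omega_comp (@norm_continuous _ _)).
      by apply: continuous_OmegaM => //; exact: continuous_OmegaM.
    apply: (continuous_Omega_comp (@norm_continuous _ _)).
    by apply: continuous_Omega_fst => r _; exact: continuous_inner_cutoff'.
  set f := (fun r t : R => _) in cf.
  have d2 : 2 * dlt <= d by move: dlt1 T0 tau0 rho0; rewrite /d /S; clear; lra.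
  have -> : 8 * K * dlt = 8 * K * (2 * dlt - dlt) by ring.
  have -> : \int[mu]_(r in `[dlt, d]) (`|pderiv 1 0 z r (T + sg * tau)
      * pderiv 0 1 z r (T + sg * tau) * r ^+ n.-1|
      * `|inner_cutoff' dlt r| * outer_cutoff rho (r + tau)) =
      \int[mu]_(r in `[dlt, 2 * dlt]) f r (T + sg * tau).
    apply: Rintegral_support.
      move=> r; rewrite /= !in_itv/= => /andP[-> /=]; move: d2; clear; lra.
    move=> r /=; rewrite !in_itv/= => /andP[-> _] /negP; rewrite /= -ltNge => /ltW rd.
    by have [_ ->] := inner_cutoff_large dlt0 rd; rewrite normr0 mulr0 mul0r.
  apply: (le_trans (ler_norm _)); apply: Rintegral_segment_bound.
  - by move: dlt0; clear; lra.
  - move=> r /andP[dr _]; apply: continuous_Omega_l => //; exact: lt_le_trans dr.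
  - move=> r /andP[dr rd]; have r0 : 0 < r by exact: lt_le_trans dr.
    have r1 : r <= 1 by move: rd dlt1; clear; lra.
    have b0 := outer_cutoff_ge0 rho (r + tau).
    have b1 : outer_cutoff rho (r + tau) <= 1.
      by apply: outer_cutoff_le1 => //; case/andP: htau r0; clear; lra.
    rewrite /f ger0_norm; last by apply: mulr_ge0 => //; exact: mulr_ge0.
    (* The flux is at most K r <= 2 K dlt and the slope of the cutoff at most 4 / dlt; the length
       dlt of the interval supplies the small factor. *)
    have -> : 8 * K = K * (2 * dlt) * (4 / dlt) * 1.
      by have dn : dlt != 0; [rewrite gt_eqF|field].
    apply: ler_pM => //.
    apply: ler_pM => //; last exact: normr_inner_cutoff'.
    apply: le_trans (hK r _ _ (st _ htau)) _; first by rewrite r0.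
    by rewrite ler_wpM2l.
have Qle tau lam : 0 <= tau <= tau1 -> 0 < lam ->
    sg * Q (T + sg * tau) <= 8 * K * dlt + lam * En (T + sg * tau) + (2 * lam)^-1 * N tau ^+ 2.
  move=> htau lam0; set t := T + sg * tau.
  have cr : continuous_Omega (fun r t => energy_rate z G a ar at_ r t * r ^+ n.-1).
    by apply: continuous_OmegaM => //; exact: continuous_energy_rate.
  have c1 : continuous_Omega (fun r t => `|pderiv 1 0 z r t * pderiv 0 1 z r t * r ^+ n.-1|
      * `|inner_cutoff' dlt r| * outer_cutoff rho (r + tau)).
    apply: continuous_OmegaM.
      apply: continuous_OmegaM.
        apply: (continuous_Omega_comp (@norm_continuous _ _)).
        by apply: continuous_OmegaM => //; exact: continuous_OmegaM.
      apply: (continuous_Omega_comp (@norm_continuous _ _)).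
      by apply: continuous_Omega_fst => r _; exact: continuous_inner_cutoff'.
    apply: continuous_Omega_fst => r _.
    exact: is_derive_continuous (is_derive_shift (is_derive_outer_cutoff rho (r + tau))).
  have c2 : continuous_Omega (fun r t => lam * (energy_density z r t * a r t * r ^+ n.-1)).
    by apply: continuous_OmegaM => //; exact: continuous_Omega_cst.
  have c3 : continuous_Omega (fun r t => G r t ^+ 2 * r ^+ n.-1).
    by apply: continuous_OmegaM => //; exact: continuous_OmegaM.
  have c4 : continuous_Omega (fun r t => (2 * lam)^-1 * (G r t ^+ 2 * r ^+ n.-1)).
    by apply: continuous_OmegaM => //; exact: continuous_Omega_cst.
  have c5 : continuous_Omega (fun r t => sg * (energy_rate z G a ar at_ r t * r ^+ n.-1)).
    by apply: continuous_OmegaM => //; exact: continuous_Omega_cst.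
  have c12 := continuous_OmegaD c1 c2; have c123 := continuous_OmegaD c12 c4.
  rewrite /Q -(@RintegralZl _ _ R mu _ _ sg mcd (int _ t cr)).
  apply: le_trans (@le_Rintegral _ _ R mu _ _ _ mcd (int _ t c5) (int _ t c123) _) _.
    move=> r; rewrite /= in_itv/= => hr; have r0 := rpos _ hr.
    have b0 := outer_cutoff_ge0 rho (r + tau).
    have b1 : outer_cutoff rho (r + tau) <= 1.
      by apply: outer_cutoff_le1 => //; case/andP: htau r0; clear; lra.
    rewrite /energy_rate /at_ /ar /a /t xtau.
    apply: energy_rate_le => //; [exact: inner_cutoff_bounds|by rewrite b0|exact: outer_cutoff'_le0|].
    exact: exprn_ge0 (ltW r0).
  rewrite (@RintegralD _ _ R mu _ _ _ mcd (int _ t c12) (int _ t c4)).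
  rewrite (@RintegralD _ _ R mu _ _ _ mcd (int _ t c1) (int _ t c2)).
  rewrite (@RintegralZl _ _ R mu _ _ lam mcd (int _ t cEa)).
  rewrite (@RintegralZl _ _ R mu _ _ (2 * lam)^-1 mcd (int _ t c3)).
  apply: lerD; first by rewrite lerD2r; exact: flux.
  by apply: ler_wpM2l; [rewrite invr_ge0 mulr_ge0// ltW|exact: hN].
have mE (tau : R) : 0 <= tau <= tau1 ->
    is_derive tau 1 (fun x => En (T + sg * x)) (sg * Q (T + sg * tau)).
  move=> htau; rewrite mulrC.
  apply: (@is_derive1_comp R En (fun x => T + sg * x)).
    apply: dE; rewrite -ltr_norml; apply: (le_lt_trans (st _ htau)).
    by rewrite /S ltrDl.
  rewrite -[X in is_derive _ _ _ X]add0r; apply: is_deriveD.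
  rewrite -[X in is_derive _ _ _ X]mulr1; apply: is_deriveZ.
pose Y tau := Num.sqrt (En (T + sg * tau) + eta ^+ 2).
have eta2 : 0 < eta ^+ 2 by rewrite exprn_gt0.
have Ypos tau : 0 < En (T + sg * tau) + eta ^+ 2 by rewrite ltr_wpDl.
have Yeta tau : eta <= Y tau.
  by rewrite -[leLHS](gtr0_norm eta0) -sqrtr_sqr ler_sqrt// ?lerDr// ltW.
have Y2 tau : Y tau ^+ 2 = En (T + sg * tau) + eta ^+ 2 by rewrite sqr_sqrtr// ltW.
have dY (tau : R) : 0 <= tau <= tau1 ->
    is_derive tau 1 Y ((2 * Y tau)^-1 * (sg * Q (T + sg * tau))).
  move=> htau; apply: (@is_derive1_comp R Num.sqrt (fun x => En (T + sg * x) + eta ^+ 2)).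
    exact: is_derive1_sqrt.
  rewrite -[X in is_derive _ _ _ X]addr0; apply: is_deriveD; exact: mE.
have dYP (tau : R) : 0 <= tau <= tau1 -> is_derive tau 1 (fun x => Y x - Phi x)
    ((2 * Y tau)^-1 * (sg * Q (T + sg * tau)) - N tau).
  by move=> htau; apply: is_deriveB; [exact: dY|exact: dPhi].
have dYle tau : 0 <= tau <= tau1 ->
    (2 * Y tau)^-1 * (sg * Q (T + sg * tau)) - N tau <= 4 * K * dlt / eta.
  move=> htau; have Nt := N0 _ htau; have Yt : 0 < Y tau by exact: lt_le_trans (Yeta tau).
  (* With lam = N / Y both source terms become multiples of N Y, namely at most N Y and N Y / 2.
     After division by 2 Y they contribute 3/4 N, which the primitive [Phi] absorbs. *)
  have := Qle tau (N tau / Y tau) htau (divr_gt0 Nt Yt).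
  have e1 : (2 * (N tau / Y tau))^-1 * N tau ^+ 2 = N tau * Y tau / 2.
    by have yn : Y tau != 0; [rewrite gt_eqF|have nn : N tau != 0; [rewrite gt_eqF|field; rewrite yn nn]].
  have e2 : N tau / Y tau * En (T + sg * tau) <= N tau * Y tau.
    rewrite -mulrA ler_pM2l// mulrC ler_pdivrMr// -expr2 Y2 lerDl ltW//.
  rewrite e1 => q1.
  have q2 : sg * Q (T + sg * tau) <= 8 * K * dlt + 3 / 2 * (N tau * Y tau).
    by move: q1 e2; clear; lra.
  have i0 : 0 <= (2 * Y tau)^-1 by rewrite invr_ge0 mulr_ge0// ltW.
  have q3 := ler_wpM2l i0 q2.
  have e3 : (2 * Y tau)^-1 * (8 * K * dlt + 3 / 2 * (N tau * Y tau)) =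
      4 * K * dlt / Y tau + 3 / 4 * N tau.
    by have yn : Y tau != 0; [rewrite gt_eqF|field].
  have q4 : 4 * K * dlt / Y tau <= 4 * K * dlt / eta.
    apply: ler_wpM2l; first by rewrite !mulr_ge0// ltW.
    by rewrite lef_pV2// posrE.
  by move: q3 q4 Nt; rewrite e3; clear; lra.
(* One eta is the initial value of [Y], the energy being 0 at time T; the other is the flux error
   integrated up to tau1. *)
have Yend : Y tau1 <= 2 * eta + (Phi tau1 - Phi 0).
  have [x||c hc E] := @MVT_segment R (fun x => Y x - Phi x)
    (fun x => (2 * Y x)^-1 * (sg * Q (T + sg * x)) - N x) 0 tau1 (ltW tau0).
  - by rewrite in_itv/= => /andP[x0 x1]; apply: dYP; rewrite !ltW.
  - by apply: within_itv_continuous => x hx; exact: is_derive_continuous (dYP x hx).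
  have ET : En (T + sg * 0) = 0.
    rewrite mulr0 addr0; apply: Rintegral0 => r; rewrite /= in_itv/= => /rpos r0.
    by have [z1 z2] := z0 r r0; rewrite /energy_density z1 z2 expr0n addr0 !mul0r.
  have Y0 : Y 0 = eta by rewrite /Y ET add0r sqrtr_sqr gtr0_norm.
  have := dYle c hc; rewrite Y0 subr0 in E => dc.
  have h1 : 4 * K * dlt / eta * tau1 <= eta.
    by rewrite mulrAC ler_pdivrMr// -expr2; move: dlt2 dlt0; clear; lra.
  by have := ler_wpM2r (ltW tau0) dc; move: E h1; clear; lra.
have Eend : En (T + sg * tau1) <= (2 * eta + (Phi tau1 - Phi 0)) ^+ 2.
  apply: (@le_trans _ _ (Y tau1 ^+ 2)); first by rewrite Y2 lerDl ltW.
  have Y1 : 0 <= Y tau1 by exact: le_trans (ltW eta0) (Yeta tau1).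
  by apply: lerXn2r => //; rewrite nnegrE//; exact: le_trans Yend.
pose f r := (pderiv 1 0 z r (T + sg * tau1) ^+ 2 + pderiv 0 1 z r (T + sg * tau1) ^+ 2)
  * (inner_cutoff dlt r * outer_cutoff rho (r + tau1)) * r ^+ n.-1.
have fE r : f r = 2 * (energy_density z r (T + sg * tau1) * a r (T + sg * tau1) * r ^+ n.-1).
  by rewrite /f /energy_density /a xtau; field.
apply: (@le_trans _ _ (\int[mu]_(r in `[dlt, d]) (f r)%:E)%E).
  rewrite le_eqVlt; apply/orP; left; apply/eqP; apply: integral_support.
    by move=> r; rewrite /= !in_itv/= andbT => /rpos.
  move=> r; rewrite /= !in_itv/= andbT => r0 /negP rd.
  have tS : `|T + sg * tau1| <= S.
    by apply: (le_trans (st tau1 _)); rewrite ?lexx ?ltW// /S ltrDl.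
  by have [a1 _ _] := va r _ r0 tS rd; apply: etrans (fE r) _; rewrite a1 mulr0 mul0r mulr0.
have c2 : continuous_Omega (fun r t => 2 * (energy_density z r t * a r t * r ^+ n.-1)).
  by apply: continuous_OmegaM => //; exact: continuous_Omega_cst.
have i2 := int _ (T + sg * tau1) c2.
have -> : (\int[mu]_(r in `[dlt, d]) (f r)%:E =
    (\int[mu]_(r in `[dlt, d])
      (2 * (energy_density z r (T + sg * tau1) * a r (T + sg * tau1) * r ^+ n.-1)))%R%:E)%E.
  rewrite /Rintegral fineK; last exact: integrable_fin_num.
  by apply: eq_integral => r _; congr EFin; exact: fE.
rewrite lee_fin (@RintegralZl _ _ R mu _ _ 2 mcd (int _ _ cEa)).
by rewrite ler_pM2l.
Qed.

End EnergyInequality.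

(** * Decay of the source *)

Section SourceDecay.
Context {R : realType}.

(** A x + B y >= min(x, y). After exponentiation, a decay shared between <r> and <|t|-r> is bounded
    by one of the two integrable profiles <r>^(-2), <|t|-r>^(-2). *)
Lemma interpolate_exponents (A B x y : R) : 0 <= A -> 0 <= B -> 1 <= A + B -> 0 <= x -> 0 <= y ->
  - 2 * A * x - 2 * B * y <= - 2 * x \/ - 2 * A * x - 2 * B * y <= - 2 * y.
Proof.
move=> A0 B0 AB x0 y0; case: (leP x y) => [xy|/ltW yx]; [left|right].
  have h1 := ler_wpM2l B0 xy; have h2 := ler_wpM2r x0 AB; lra.
have h1 := ler_wpM2l A0 yx; have h2 := ler_wpM2r y0 AB; lra.
Qed.

(** [lx], [ly], [lz], [ls] stand for the logarithms of [<r>], [<|t|-r>],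
    [<|t|+r>], [<t>], and [l2] for [ln 2]; either [<t> <= 2<r>], or [<r> <= <t>]
    and [<t> <= 2<|t|-r>]. The two conclusions are the F and V parts of the source. *)
Lemma source_exponents (a m nu p q kap lx ly lz ls l2 : R) :
  0 < a -> a <= 1 -> 0 < m -> 0 < nu -> 1 < p -> 2 < kap ->
  0 < q -> q <= a + nu -> q <= (a + m) * (p - 1) -> q <= 2 ->
  2 <= (m + a + nu) * (p - 1) ->
  0 <= l2 -> 0 <= lx -> 0 <= ly -> 0 <= ls -> lx <= lz -> ls <= lz ->
  (ls <= lx + l2 \/ lx <= ls /\ ls <= ly + l2) ->
  let C := 2 * (q + nu * p + nu) * l2 in
  ((2 * a - 2 * m * (p - 1)) * lx - 2 * a * p * lz - 2 * nu * p * ly <= C - 2 * q * ls - 2 * lx \/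
   (2 * a - 2 * m * (p - 1)) * lx - 2 * a * p * lz - 2 * nu * p * ly <= C - 2 * q * ls - 2 * ly) /\
  ((2 * a - 2 * kap) * lx - 2 * a * lz - 2 * nu * ly <= C - 2 * q * ls - 2 * lx \/
   (2 * a - 2 * kap) * lx - 2 * a * lz - 2 * nu * ly <= C - 2 * q * ls - 2 * ly).
Proof.
move=> a0 a1 m0 nu0 p1 kap2 q0 q1 q2 q3 k2 l20 lx0 ly0 ls0 xz sz reg C.
have np0 : 0 <= nu * p by rewrite mulr_ge0 ?ltW//; apply: lt_trans p1.
have ap0 : 0 <= a * p by rewrite mulr_ge0 ?ltW//; apply: lt_trans p1.
have C1 : 2 * q * l2 <= C.
  have := mulr_ge0 np0 l20; have := mulr_ge0 (ltW nu0) l20; rewrite /C; lra.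
have C2 : 2 * (nu * p) * l2 <= C.
  have := mulr_ge0 (ltW q0) l20; have := mulr_ge0 (ltW nu0) l20; rewrite /C; lra.
have C3 : 2 * nu * l2 <= C.
  have := mulr_ge0 (ltW q0) l20; have := mulr_ge0 np0 l20; rewrite /C; lra.
case: reg => [sx|[xs sy]].
- have qs := ler_wpM2l (ltW q0) sx.
  split.
  + have apz := ler_wpM2l ap0 xz.
    have A0 : 0 <= (a + m) * (p - 1) - q by lra.
    (* This is where k (p - 1) >= 2 enters: it makes the sum at least 2 + nu - q, and q <= a + nu <=
       1 + nu. *)
    have AB : 1 <= ((a + m) * (p - 1) - q) + nu * p by lra.
    by case: (interpolate_exponents A0 np0 AB lx0 ly0); [left|right]; lra.
  + have az := ler_wpM2l (ltW a0) xz.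
    have A0 : 0 <= kap - q by lra.
    have AB : 1 <= (kap - q) + nu by lra.
    by case: (interpolate_exponents A0 (ltW nu0) AB lx0 ly0); [left|right]; lra.
- split; left.
  + have apz := ler_wpM2l ap0 sz.
    have npy := ler_wpM2l np0 sy.
    have g0 : q <= p * (a + nu).
      by apply: (le_trans q1); rewrite ler_peMl ?addr_ge0 ?(ltW a0) ?(ltW nu0)// ltW.
    have g1 : a + 1 - m * (p - 1) <= p * (a + nu) - q by lra.
    (* In this region <r> <= <t>, so a remaining positive power of <r> is paid for with the spare
       decay in <t>; a negative one is dropped. *)
    have g2 : (a + 1 - m * (p - 1)) * lx <= (p * (a + nu) - q) * ls.
      case: (leP 0 (a + 1 - m * (p - 1))) => [c0|/ltW c0].
        have := ler_wpM2l c0 xs; have := ler_wpM2r ls0 g1; lra.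
      have g3 : 0 <= p * (a + nu) - q by lra.
      have := mulr_le0_ge0 c0 lx0; have := mulr_ge0 g3 ls0; lra.
    lra.
  + have az := ler_wpM2l (ltW a0) sz.
    have ny := ler_wpM2l (ltW nu0) sy.
    have ka : 1 <= kap - a by lra.
    have k3 := ler_wpM2r lx0 ka.
    have k4 := ler_wpM2r ls0 q1.
    lra.
Qed.

Lemma jap_ge1 (x : R) : 1 <= jap x.
Proof. by rewrite /jap lerDl. Qed.

Lemma jap_gt0 (x : R) : 0 < jap x.
Proof. exact: lt_le_trans (jap_ge1 x). Qed.

Lemma powR_expR (x e : R) : 0 < x -> x `^ e = expR (e * ln x).
Proof. by move=> x0; rewrite /powR gt_eqF. Qed.

(** The factor [(r / <r>)^e], with [- 1 < e <= 0], absorbs the singularity of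
    [|F(u)|^2 r^(n-1)] on the axis. *)
Definition decay_profile (e r s : R) : R :=
  (r / jap r) `^ e * ((jap r ^+ 2)^-1 + (jap (s - r) ^+ 2)^-1).

Lemma expR_N2ln (x : R) : 0 < x -> expR (- 2 * ln x) = (x ^+ 2)^-1.
Proof. by move=> x0; rewrite -powR_expR// powRN powR_mulrn// ltW. Qed.

Lemma log_regions (r s : R) : 0 < r -> 0 <= s ->
  [/\ 0 <= ln (jap r), 0 <= ln (jap (s - r)), 0 <= ln (jap s),
      ln (jap r) <= ln (jap (s + r)) /\ ln (jap s) <= ln (jap (s + r)) &
      ln (jap s) <= ln (jap r) + ln 2 \/
      ln (jap r) <= ln (jap s) /\ ln (jap s) <= ln (jap (s - r)) + ln 2].
Proof.
move=> r0 s0.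
have l (x y : R) : jap x <= y -> ln (jap x) <= ln y.
  move=> xy; have y0 : 0 < y by exact: lt_le_trans (jap_gt0 x) xy.
  by rewrite ler_ln ?posrE ?jap_gt0.
have l2 (x : R) : ln (jap x) + ln 2 = ln (jap x * 2) by rewrite lnM// posrE ?jap_gt0.
have l0 (x : R) : 0 <= ln (jap x) by rewrite -(@ln1 R) ler_ln ?posrE ?jap_gt0// jap_ge1.
have jr : jap r = 1 + r by rewrite /jap gtr0_norm.
have js : jap s = 1 + s by rewrite /jap ger0_norm.
have jsr : jap (s + r) = 1 + s + r by rewrite /jap gtr0_norm ?addrA//; lra.
split; [exact: l0|exact: l0|exact: l0|split; apply: l; rewrite ?jr ?js jsr; lra|].
rewrite !l2; case: (leP (jap s) (jap r * 2)) => h; [left|right; split]; apply: l => //.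
  by move: h; rewrite jr js; lra.
have := ler_norm (s - r); move: h; rewrite jr js /jap; lra.
Qed.

(** In logarithms every factor becomes an exponential of a linear form, and the claim reduces to
    [source_exponents]. The powers of r left at the axis are rewritten as powers of r / <r>, which
    [decay_profile] absorbs. *)
Lemma source_decay (a m nu p q kap U CF V0 e : R) :
  0 < a -> a <= 1 -> 0 < m -> 0 < nu -> 1 < p -> 2 < kap ->
  0 < q -> q <= a + nu -> q <= (a + m) * (p - 1) -> q <= 2 ->
  2 <= (m + a + nu) * (p - 1) -> 0 < U -> 0 <= CF -> 0 <= V0 ->
  e <= 0 -> e <= 2 * p * (1 - m) + 2 * m + 2 * a ->
  exists2 M, 0 <= M & forall r s u f v : R, 0 < r -> 0 <= s ->
    `|u| <= U * r `^ (1 - m) * (jap r)^-1 * (jap (s + r) `^ a * jap (s - r) `^ nu)^-1 ->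
    `|f| <= CF * `|u| `^ p -> `|v| <= V0 * jap r `^ (- kap) ->
    (f - v * u) ^+ 2 * r `^ (2 * m + 2 * a) <= M * jap s `^ (- (2 * q)) * decay_profile e r s.
Proof.
move=> a0 a1 m0 nu0 p1 kap2 q0 q1 q2 q3 k2 U0 CF0 V00 e0 e1.
have p0 : 0 < p by exact: lt_trans p1.
pose C := 2 * (q + nu * p + nu) * ln (2 : R).
pose M1 := 2 * (CF * U `^ p) ^+ 2; pose M2 := 2 * (V0 * U) ^+ 2.
have M10 : 0 <= M1 by rewrite mulr_ge0 ?sqr_ge0.
have M20 : 0 <= M2 by rewrite mulr_ge0 ?sqr_ge0.
exists ((M1 + M2) * expR C) => [|r s u f v r0 s0 hu hf hv].
  by rewrite mulr_ge0 ?addr_ge0 ?expR_ge0.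
have [lx0 ly0 ls0 [xz sz] reg] := log_regions r0 s0.
have l20 : 0 <= ln (2 : R) by rewrite ln_ge0// ler1n.
have [HF HV] := source_exponents a0 a1 m0 nu0 p1 kap2 q0 q1 q2 q3 k2 l20 lx0 ly0 ls0 xz sz reg.
set lx := ln (jap r) in HF HV lx0; set ly := ln (jap (s - r)) in HF HV ly0.
set lz := ln (jap (s + r)) in HF HV; set ls := ln (jap s) in HF HV ls0.
pose lr := ln r.
have lrx : lr <= lx.
  by rewrite /lr /lx ler_ln ?posrE ?jap_gt0// /jap gtr0_norm// lerDr.
have lrx0 : 0 <= e * (lr - lx) by rewrite mulr_le0// subr_le0.
pose L := (1 - m) * lr - lx - (a * lz + nu * ly).
have {}hu : `|u| <= U * expR L.
  apply: (le_trans hu); rewrite !powR_expR ?jap_gt0// -/lr -/lz -/ly -expRD -expRN.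
  rewrite -[X in X^-1](@lnK R) ?posrE ?jap_gt0// -/lx -expRN -!mulrA -!expRD.
  by rewrite le_eqVlt /L opprD addrA eqxx.
have {}hf : `|f| <= CF * U `^ p * expR (p * L).
  apply: (le_trans hf); rewrite -mulrA ler_wpM2l//.
  apply: (@le_trans _ _ ((U * expR L) `^ p)).
    by apply: ge0_ler_powR; rewrite ?nnegrE ?mulr_ge0 ?expR_ge0 ?(ltW U0) ?(ltW p0).
  by rewrite powRM ?expR_ge0 ?(ltW U0)// mulrC -expRM [L * p]mulrC mulrC.
have {}hv : `|v * u| <= V0 * U * expR (- kap * lx + L).
  rewrite normrM expRD; have -> : V0 * U * (expR (- kap * lx) * expR L) =
    V0 * expR (- kap * lx) * (U * expR L) by ring.
  apply: ler_pM => //; apply: (le_trans hv); rewrite powR_expR ?jap_gt0//.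
have sqle (x y : R) : `|x| <= y -> x ^+ 2 <= y ^+ 2.
  by move=> xy; rewrite -real_normK ?num_real//; apply: lerXn2r => //; rewrite nnegrE// (le_trans _ xy).
have hsq : (f - v * u) ^+ 2 <= M1 * expR (2 * p * L) + M2 * expR (- 2 * kap * lx + 2 * L).
  have k1 := sqle _ _ hf; have k2' := sqle _ _ hv.
  have -> : M1 * expR (2 * p * L) = 2 * (CF * U `^ p * expR (p * L)) ^+ 2.
    have -> : expR (2 * p * L) = expR (p * L) * expR (p * L).
      by rewrite -expRD; congr expR; ring.
    by rewrite /M1; ring.
  have -> : M2 * expR (- 2 * kap * lx + 2 * L) = 2 * (V0 * U * expR (- kap * lx + L)) ^+ 2.
    have -> : expR (- 2 * kap * lx + 2 * L) = expR (- kap * lx + L) * expR (- kap * lx + L).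
      by rewrite -expRD; congr expR; ring.
    by rewrite /M2; ring.
  have := sqr_ge0 (f + v * u); rewrite sqrrD sqrrB; lra.
set P := decay_profile e r s.
have PE : P = expR (e * (lr - lx)) * (expR (- 2 * lx) + expR (- 2 * ly)).
  rewrite /P /decay_profile powR_expR ?divr_gt0 ?jap_gt0// ln_div ?posrE ?jap_gt0//.
  by rewrite /lx /ly !expR_N2ln ?jap_gt0.
rewrite powR_expR// -/lr [X in _ <= _ * X * _]powR_expR ?jap_gt0// -/ls.
have main X : X <= C - 2 * q * ls - 2 * lx + e * (lr - lx) \/
     X <= C - 2 * q * ls - 2 * ly + e * (lr - lx) ->
     expR X <= expR C * expR (- (2 * q) * ls) * P.
  move=> H; rewrite PE mulrA -!expRD mulrDr -!expRD.
  case: H => H; [apply: (@le_trans _ _ (expR (C + - (2 * q) * ls + e * (lr - lx) + - 2 * lx)))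
    | apply: (@le_trans _ _ (expR (C + - (2 * q) * ls + e * (lr - lx) + - 2 * ly)))];
    rewrite ?ler_expR ?lerDl ?lerDr ?expR_ge0//; move: H; clear; lra.
have lra1 : 0 <= lx - lr by rewrite subr_ge0.
have T1 : expR (2 * p * L) * expR ((2 * m + 2 * a) * lr) <= expR C * expR (- (2 * q) * ls) * P.
  rewrite -expRD; apply: main.
  (* Lowering the exponent of r / <r> <= 1 to [e] increases the power. *)
  have h1 : (2 * p * (1 - m) + 2 * m + 2 * a) * (lr - lx) <= e * (lr - lx).
    by rewrite ler_wnM2r// subr_le0.
  have h2 : 2 * p * L + (2 * m + 2 * a) * lr =
    (2 * p * (1 - m) + 2 * m + 2 * a) * (lr - lx) +
    ((2 * a - 2 * m * (p - 1)) * lx - 2 * a * p * lz - 2 * nu * p * ly).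
    by rewrite /L; ring.
  by case: HF => HF; [left|right]; rewrite h2; move: h1 HF; rewrite -/C; clear; lra.
have T2 : expR (- 2 * kap * lx + 2 * L) * expR ((2 * m + 2 * a) * lr) <=
    expR C * expR (- (2 * q) * ls) * P.
  rewrite -expRD; apply: main.
  (* The potential term is linear in u: its square carries r^(2+2a), which is not singular, and
     since e <= 0 the factor (r / <r>)^e >= 1 is inserted for free. *)
  have h1 : (2 + 2 * a) * lr <= (2 + 2 * a) * lx.
    by rewrite ler_wpM2l//; move: a0; clear; lra.
  have h2 : - 2 * kap * lx + 2 * L + (2 * m + 2 * a) * lr = (2 + 2 * a) * lr - (2 + 2 * a) * lx
     + ((2 * a - 2 * kap) * lx - 2 * a * lz - 2 * nu * ly).
    by rewrite /L; ring.
  by case: HV => HV; [left|right]; rewrite h2; move: h1 HV lrx0; rewrite -/C; clear; lra.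
apply: (le_trans (ler_wpM2r (expR_ge0 _) hsq)).
have := ler_wpM2l M10 T1; have := ler_wpM2l M20 T2.
have -> : (M1 + M2) * expR C * expR (- (2 * q) * ls) * P =
  M1 * (expR C * expR (- (2 * q) * ls) * P) + M2 * (expR C * expR (- (2 * q) * ls) * P) by ring.
by move=> h2 h1; rewrite [leLHS]mulrDl -(mulrA M1) -(mulrA M2); apply: lerD.
Qed.

End SourceDecay.

(** * Uniform bounds for the radial integral of the source *)

Section SourceIntegral.
Context {R : realType}.
Local Notation mu := (@lebesgue_measure R).

(** With y = r / (1 + r) this is y^e dy/dr, so it has the primitive y^(e+1) / (e+1), bounded on the
    half-line when e > -1. *)
Definition axis_profile (e r : R) : R := (r / (1 + r)) `^ e * ((1 + r) ^+ 2)^-1.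

Lemma is_derive_mobius (r : R) : 0 < r ->
  is_derive r 1 (fun x => x / (1 + x)) ((1 + r) ^+ 2)^-1.
Proof.
move=> r0; have n0 : 1 + r != 0 by rewrite gt_eqF//; lra.
have H : is_derive r 1 (fun x => (1 + x)^-1) (- (1 + r) ^- 2 *: 1).
  apply: is_deriveV => //.
  rewrite -[X in is_derive _ _ _ X]add0r; apply: is_deriveD.
rewrite (_ : ((1 + r) ^+ 2)^-1 = r *: (- (1 + r) ^- 2 *: 1) + (1 + r)^-1 *: 1).
  exact: is_deriveM.
by rewrite /GRing.scale /=; field.
Qed.

Lemma is_derive_axis_profile (e r : R) : -1 < e -> 0 < r ->
  is_derive r 1 (fun x => (e + 1)^-1 * (x / (1 + x)) `^ (e + 1)) (axis_profile e r).
Proof.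
move=> e1 r0; have y0 : 0 < r / (1 + r) by rewrite divr_gt0//; lra.
have H := @is_derive1_comp R (fun y => y `^ (e + 1)) _ r _ _ (is_derive1_powR (e + 1) y0)
  (is_derive_mobius r0).
have := is_deriveZ (e + 1)^-1 H.
rewrite addrK /axis_profile (_ : _ *: _ = (r / (1 + r)) `^ e * ((1 + r) ^+ 2)^-1) //.
by rewrite /GRing.scale /= !mulrA mulVf ?mul1r// gt_eqF//; lra.
Qed.

Lemma continuous_axis_profile (e r : R) : 0 < r -> {for r, continuous (axis_profile e)}.
Proof.
move=> r0; have y0 : 0 < r / (1 + r) by rewrite divr_gt0//; lra.
have dm := is_derive_mobius r0.
have H := @is_derive1_comp R (fun y => y `^ e) _ r _ _ (is_derive1_powR e y0) dm.
apply: cvgM; first exact: is_derive_continuous H.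
apply: cvgV; first by rewrite expf_neq0// gt_eqF//; lra.
by apply: cvgM; apply: cvgD; try exact: cvg_cst; exact: cvg_id.
Qed.

Lemma Rintegral_axis_profile (e c d : R) : -1 < e -> 0 < c -> c <= d ->
  \int[mu]_(r in `[c, d]) axis_profile e r <= (e + 1)^-1.
Proof.
move=> e1 c0 cd; have h r : c <= r <= d -> 0 < r by move=> /andP[+ _]; exact: lt_le_trans.
rewrite (@Rintegral_FTC2 _ _ (fun x => (e + 1)^-1 * (x / (1 + x)) `^ (e + 1)) c d cd
  (fun r hr => @continuous_axis_profile e r (h r hr)) (fun r hr => is_derive_axis_profile e1 (h r hr))).
have d0 : 0 < d by exact: lt_le_trans cd.
have i0 : 0 <= (e + 1)^-1 by rewrite invr_ge0; lra.
have p1 : (d / (1 + d)) `^ (e + 1) <= 1.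
  apply: (@le_trans _ _ (1 `^ (e + 1))); last by rewrite powR1.
  apply: ge0_ler_powR; rewrite ?nnegrE//; first by lra.
    by rewrite divr_ge0//; lra.
  by rewrite ler_pdivrMr; lra.
have p2 := mulr_ge0 i0 (powR_ge0 (c / (1 + c)) (e + 1)).
have := ler_wpM2l i0 p1; lra.
Qed.

Lemma continuous_cauchy_profile (s r : R) : {for r, continuous (fun r => (1 + (r - s) ^+ 2)^-1)}.
Proof.
apply: cvgV; first by rewrite gt_eqF// ltr_pwDl ?sqr_ge0.
apply: cvgD; first exact: cvg_cst.
by apply: cvgM; apply: cvgB; try exact: cvg_cst; exact: cvg_id.
Qed.

Lemma Rintegral_cauchy_profile (s c d : R) : c <= d ->
  \int[mu]_(r in `[c, d]) (1 + (r - s) ^+ 2)^-1 <= pi.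
Proof.
move=> cd.
have dF (r : R) : is_derive r 1 (fun x => atan (x - s)) (1 + (r - s) ^+ 2)^-1.
  exact: (is_derive_shift (is_derive1_atan (r + - s))).
rewrite (@Rintegral_FTC2 _ _ (fun x => atan (x - s)) c d cd
  (fun r _ => @continuous_cauchy_profile s r) (fun r _ => dF r)).
by have := atan_ltpi2 (d - s); have := atan_gtNpi2 (c - s); lra.
Qed.

(** For r >= 1 the power of r / (1 + r) is at most 2. For r < 1 the second summand is at most 1 <= 4
    / (1 + r)^2 and joins the first, whence 5 = 1 + 4. *)
Lemma decay_profile_le (e r s : R) : -1 < e -> e <= 0 -> 0 < r ->
  decay_profile e r s <= 5 * axis_profile e r + 2 * (1 + (r - s) ^+ 2)^-1.
Proof.
move=> e1 e0 r0; rewrite /decay_profile /axis_profile.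
have -> : jap r = 1 + r by rewrite /jap gtr0_norm.
set w := (r / (1 + r)) `^ e; have w0 : 0 <= w by exact: powR_ge0.
set y := (jap (s - r) ^+ 2)^-1; set x := ((1 + r) ^+ 2)^-1.
have y0 : 0 <= y by rewrite invr_ge0 sqr_ge0.
have x0 : 0 <= x by rewrite invr_ge0 sqr_ge0.
have yle : y <= (1 + (r - s) ^+ 2)^-1.
  have q0 := sqr_ge0 (r - s).
  have j0 := exprn_gt0 2 (jap_gt0 (s - r)).
  rewrite /y lef_pV2 ?posrE//; last by lra.
  by rewrite /jap distrC -(real_normK (num_real (r - s))); have := normr_ge0 (r - s); nra.
have y1 : y <= 1 by rewrite invf_le1 ?exprn_gt0 ?jap_gt0// exprn_ege1// jap_ge1.
rewrite mulrDr; case: (leP 1 r) => r1.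
  have w2 : w <= 2.
    have z0 : 0 < r / (1 + r) by rewrite divr_gt0//; lra.
    have -> : w = ((1 + r) / r) `^ (- e).
      by rewrite -[(1 + r) / r]invf_div /w !powR_expR ?invr_gt0// lnV ?posrE// mulrNN.
    apply: (@le_trans _ _ (2 `^ (- e))).
      apply: ge0_ler_powR; rewrite ?nnegrE//; first by lra.
        by rewrite divr_ge0//; lra.
      by rewrite ler_pdivrMr//; lra.
    by apply: ler1_powR; lra.
  have := ler_wpM2r y0 w2; have := mulr_ge0 w0 x0; lra.
have x4 : 1 <= 4 * x.
  have n0 : 0 < (1 + r) ^+ 2 by rewrite exprn_gt0//; lra.
  by rewrite /x ler_pdivlMr// mul1r; nra.
have h1 := ler_wpM2l w0 (le_trans y1 x4).
have := mulr_ge0 w0 x0; lra.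
Qed.

Lemma Rintegral_decay_profile_le (e s K c d : R) (g : R -> R) :
  -1 < e -> e <= 0 -> 0 <= K -> 0 < c -> c <= d ->
  (forall r, c <= r <= d -> {for r, continuous g}) ->
  (forall r, c <= r <= d -> g r <= K * decay_profile e r s) ->
  \int[mu]_(r in `[c, d]) g r <= K * (5 / (e + 1) + 2 * pi).
Proof.
move=> e1 e0 K0 c0 cd cg gK.
have h r : c <= r <= d -> 0 < r by move=> /andP[+ _]; exact: lt_le_trans.
have mcd : measurable (`[c, d] : set R) by exact: measurable_itv.
have i1 : mu.-integrable `[c, d] (EFin \o axis_profile e).
  by apply: continuous_itv_integrable => r /h r0; exact: continuous_axis_profile.
have i2 : mu.-integrable `[c, d] (EFin \o (fun r => (1 + (r - s) ^+ 2)^-1)).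
  by apply: continuous_itv_integrable => r _; exact: continuous_cauchy_profile.
have c5 r : 0 < r -> {for r, continuous (fun r => 5 * axis_profile e r)}.
  by move=> r0; apply: cvgM; [exact: cvg_cst|exact: continuous_axis_profile].
have c2 r : {for r, continuous (fun r => 2 * (1 + (r - s) ^+ 2)^-1)}.
  by apply: cvgM; [exact: cvg_cst|exact: continuous_cauchy_profile].
have i5 : mu.-integrable `[c, d] (EFin \o (fun r => 5 * axis_profile e r)).
  by apply: continuous_itv_integrable => r /h; exact: c5.
have i22 : mu.-integrable `[c, d] (EFin \o (fun r => 2 * (1 + (r - s) ^+ 2)^-1)).
  by apply: continuous_itv_integrable => r _; exact: c2.
have cs r : 0 < r -> {for r, continuous (fun r => 5 * axis_profile e r + 2 * (1 + (r - s) ^+ 2)^-1)}.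
  by move=> r0; apply: cvgD; [exact: c5|exact: c2].
have is_ : mu.-integrable `[c, d]
    (EFin \o (fun r => 5 * axis_profile e r + 2 * (1 + (r - s) ^+ 2)^-1)).
  by apply: continuous_itv_integrable => r /h; exact: cs.
have iK : mu.-integrable `[c, d]
    (EFin \o (fun r => K * (5 * axis_profile e r + 2 * (1 + (r - s) ^+ 2)^-1))).
  apply: continuous_itv_integrable => r /h r0.
  by apply: cvgM; [exact: cvg_cst|exact: cs].
apply: le_trans (@le_Rintegral _ _ R mu _ _ _ mcd (continuous_itv_integrable cg) iK _) _.
  move=> r; rewrite /= in_itv/= => hr; apply: (le_trans (gK r hr)).
  by apply: ler_wpM2l => //; apply: decay_profile_le => //; exact: h.
rewrite (@RintegralZl _ _ R mu _ _ K mcd is_) (@RintegralD _ _ R mu _ _ _ mcd i5 i22).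
rewrite (@RintegralZl _ _ R mu _ _ 5 mcd i1) (@RintegralZl _ _ R mu _ _ 2 mcd i2).
apply: ler_wpM2l => //; apply: lerD; apply: ler_wpM2l => //.
  exact: Rintegral_axis_profile.
exact: Rintegral_cauchy_profile.
Qed.

End SourceIntegral.

(** * Duhamel integrals *)

Section DuhamelEnergy.
Context {R : realType}.
Local Notation mu := (@lebesgue_measure R).

Lemma limn_einf_ub (u : (\bar R)^nat) (B : \bar R) : (forall n, u n <= B)%E -> (limn_einf u <= B)%E.
Proof.
move=> uB; rewrite limn_einf_lim; apply: lime_le.
  by apply: ereal_nondecreasing_is_cvgn => m k mk;
    apply: ereal_inf_le_tmp => _ [i /= ki <-];
    exists i => //=; rewrite (leq_trans mk).
by apply: nearW => n; apply: le_trans (uB n); apply: ereal_inf_lbound; exists n => /=.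
Qed.

Lemma cvg_outer_cutoff (rho x : nat -> R) : (forall j, 0 < rho j) ->
  x j / rho j @[j --> \oo] --> 0 -> outer_cutoff (rho j) (x j) @[j --> \oo] --> (1 : R).
Proof.
move=> p0 xp; rewrite /outer_cutoff.
have H : ppart (1 - x j / rho j) @[j --> \oo] --> ppart (1 - 0).
  by apply: (cvg_comp (fun j => x j / rho j) (fun y => ppart (1 - y)) xp); exact: continuous_ppart_subl.
rewrite subr0 (@ppart_id _ 1)// in H.
rewrite (_ : (fun j => _) = (fun j => ppart (1 - x j / rho j) * ppart (1 - x j / rho j))).
  by rewrite -[X in _ --> X]mulr1; apply: cvgM.
by apply/funext => j; rewrite mulrBl divff ?expr2// gt_eqF.
Qed.

(** In both parities the volume weight r^(n-1) compensates two derivatives of size r^(-m) and leaves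
    r^(2a). *)
Lemma par_relation n : (4 <= n)%N -> 2 * m_par R n + 2 * a_par R n = n.-1%:R.
Proof.
move=> n4; rewrite /m_par /a_par -subn1 natrB; last by apply: leq_trans n4.
by case: ifP => _; field.
Qed.

Lemma a_par_bounds n : 2^-1 <= a_par R n <= 1.
Proof. by rewrite /a_par; case: ifP => _; lra. Qed.

Lemma expn_par n (r : R) : (4 <= n)%N -> 0 < r ->
  r ^+ n.-1 = r `^ (2 * m_par R n + 2 * a_par R n).
Proof. by move=> n4 r0; rewrite par_relation// powR_mulrn// ltW. Qed.

(** The flux is O(r^(2a)), and a >= 1/2 makes this O(r) for r <= 1. *)
Lemma zero_data_flux n (G z : R -> R -> R) (T s : R) : (4 <= n)%N -> zero_data_sol n G T z ->
  exists2 K, 0 <= K & forall r t : R, 0 < r <= 1 -> `|t| <= s ->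
    `|pderiv 1 0 z r t * pderiv 0 1 z r t * r ^+ n.-1| <= K * r.
Proof.
move=> n4 [_ _ /(_ s)[K hK]]; exists (K ^+ 2) => [|r t r01 ts]; first exact: sqr_ge0.
have r0 : 0 < r by case/andP: r01.
have h1 := hK 1%N 0%N r t isT r01 ts; have h2 := hK 0%N 1%N r t isT r01 ts.
rewrite addn0 subrr sub0r in h1; rewrite add0n subrr sub0r in h2.
have w0 : 0 <= r ^+ n.-1 by exact: exprn_ge0 (ltW r0).
rewrite 2!normrM (ger0_norm w0).
apply: (@le_trans _ _ (K * r `^ (- m_par R n) * (K * r `^ (- m_par R n)) * r ^+ n.-1)).
  by apply: ler_wpM2r => //; apply: ler_pM.
have -> : K * r `^ (- m_par R n) * (K * r `^ (- m_par R n)) * r ^+ n.-1 =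
    K ^+ 2 * (r `^ (- m_par R n) * r `^ (- m_par R n) * r ^+ n.-1) by ring.
apply: ler_wpM2l; first exact: sqr_ge0.
have -> : r `^ (- m_par R n) * r `^ (- m_par R n) * r ^+ n.-1 = expR (2 * a_par R n * ln r).
  by rewrite expn_par// !powR_expR// -!expRD; congr expR; ring.
have [a1 a2] := andP (a_par_bounds n); case/andP: r01 => _ r1.
apply: (@le_trans _ _ (expR (1 * ln r))); last by rewrite mul1r lnK// posrE.
by rewrite ler_expR ler_wnM2r//; [exact: ln_le0|lra].
Qed.

(** The sign condition gives |t| = - sg * t: between the initial time and t the path never crosses
    time 0, so <s> decreases at unit speed and the source bound has an explicit primitive. A single
    sequence moves the initial time, the inner radius and the outer radius together, so that Fatou's
    lemma is applied once. *)
Lemma duhamel_energy n (G w : R -> R -> R) (B : set_system R) (sg th M t : R) : (4 <= n)%N ->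
  continuous_Omega G -> (sg = 1 \/ sg = - 1) -> 0 < th -> 0 < M ->
  (forall s c d, 0 < c -> c <= d ->
     \int[mu]_(r in `[c, d]) (G r s ^+ 2 * r ^+ n.-1) <= (M * jap s `^ (- th - 1)) ^+ 2) ->
  duhamel n B G w ->
  (fun j : nat => - sg * j%:R : R) @ \oo --> B ->
  0 <= - sg * t ->
  (energy_norm n w t <= (2 * (2 + M / th) * jap t `^ (- th))%:E)%E.
Proof.
move=> n4 cG hsg th0 M0 hG [z [hz zw]] hB tsg.
have sgsg : sg * sg = 1 by case: hsg => ->; rewrite ?mulrNN mulr1.
have ht : `|t| = - sg * t.
  by rewrite -(ger0_norm tsg) normrM normrN; case: hsg => ->; rewrite ?normrN normr1 mul1r.
(* The shift by k makes every initial time precede t in the direction of evolution, so that [tau j]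
   is positive from j = 0 on. *)
have k_ex : exists k : nat, `|t| + 1 <= k%:R.
  by exists (Num.trunc (`|t| + 1)).+1; rewrite ltW// truncnS_gt.
have [k kt] := k_ex.
pose T j : R := - sg * (j + k)%:R.
have absT j : `|T j| = (j + k)%:R.
  by rewrite /T normrM normrN; case: hsg => ->; rewrite ?normrN normr1 mul1r ger0_norm.
pose tau j : R := (j + k)%:R - `|t|.
have jk (j : nat) : (j + k)%:R = j%:R + k%:R :> R by rewrite natrD.
have tau0 j : 0 < tau j by rewrite /tau jk; have : 0 <= j%:R :> R by []; lra.
have Ttau j : T j + sg * tau j = t.
  by rewrite /T /tau ht mulrBr addrA mulNr addNr add0r mulrA mulrN sgsg mulN1r opprK.
(* The regularization need not tend to 0: having the size of the claimed decay, it only enlarges the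
   constant. *)
pose eta := jap t `^ (- th); have eta0 : 0 < eta by rewrite powR_gt0// jap_gt0.
pose N j (x : R) := M * (1 + `|T j| - x) `^ (- th - 1).
pose Phi j (x : R) := M / th * (1 + `|T j| - x) `^ (- th).
have base j x : 0 <= x <= tau j -> 0 < 1 + `|T j| - x.
  by move=> /andP[_]; rewrite /tau absT; have := normr_ge0 t; lra.
have dPhi j (x : R) : 0 <= x <= tau j -> is_derive x 1 (Phi j) (N j x).
  move=> hx; have b0 := base j x hx.
  have H1 : is_derive x 1 (fun y => 1 + `|T j| - y) (- 1).
    rewrite -[X in is_derive _ _ _ X]sub0r; apply: is_deriveB.
  have H := @is_derive1_comp R (fun y => y `^ (- th)) _ x _ _ (is_derive1_powR (- th) b0) H1.
  have := is_deriveZ (M / th) H.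
  rewrite (_ : _ *: _ = N j x)//= /GRing.scale /= /N.
  by have tn : th != 0; [rewrite gt_eqF|field].
have N0 j x : 0 <= x <= tau j -> 0 < N j x.
  by move=> hx; rewrite /N mulr_gt0// powR_gt0// base.
have japT j x : 0 <= x <= tau j -> jap (T j + sg * x) = 1 + `|T j| - x.
  move=> /andP[x0 xt]; have -> : T j + sg * x = - sg * (`|T j| - x) by rewrite absT /T; ring.
  rewrite /jap normrM normrN; have -> : `|sg| = 1 by case: hsg => ->; rewrite ?normrN normr1.
  rewrite mul1r ger0_norm ?addrA// subr_ge0.
  by move: xt; rewrite /tau absT; have := normr_ge0 t; lra.
have hN j x c d : 0 <= x <= tau j -> 0 < c -> c <= d ->
    \int[mu]_(r in `[c, d]) (G r (T j + sg * x) ^+ 2 * r ^+ n.-1) <= N j x ^+ 2.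
  by move=> hx c0 cd; rewrite /N -japT//; exact: hG.
(* The cone must outgrow the elapsed time [tau j], which is linear in j, for the outer cutoff to
   tend to 1 at each fixed r. *)
pose rho (j : nat) : R := j.+1%:R ^+ 2.
have rho0 j : 0 < rho j by rewrite exprn_gt0.
pose bd : R := 2 * ((2 + M / th) * eta) ^+ 2.
have Phi_bd j : Phi j (tau j) - Phi j 0 <= M / th * eta.
  have : Phi j (tau j) = M / th * eta.
    by rewrite /Phi /eta /jap absT /tau; congr (_ * (_ `^ _)); ring.
  have : 0 <= Phi j 0 by rewrite /Phi mulr_ge0 ?powR_ge0// divr_ge0 ?ltW.
  by lra.
have Phi_mono j : 0 <= Phi j (tau j) - Phi j 0.
  have [x||c hc E] := @MVT_segment R (Phi j) (N j) 0 (tau j) (ltW (tau0 j)).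
  - by rewrite in_itv/= => /andP[x0 x1]; apply: dPhi; rewrite !ltW.
  - by apply: within_itv_continuous => x hx; exact: is_derive_continuous (dPhi j x hx).
  by rewrite E subr0 mulr_ge0 ?ltW// N0.
have cut j : exists dlt, [/\ 0 < dlt, dlt <= j.+1%:R^-1 &
    (\int[mu]_(r in `]0%R, +oo[) ((pderiv 1 0 (z (T j)) r t ^+ 2 + pderiv 0 1 (z (T j)) r t ^+ 2)
       * (inner_cutoff dlt r * outer_cutoff (rho j) (r + tau j)) * r ^+ n.-1)%:E <= bd%:E)%E].
  have [Wj z0 _] := hz (T j).
  have [K K0 hK] := zero_data_flux (`|T j| + tau j) n4 (hz (T j)).
  have zr0 r : 0 < r -> pderiv 1 0 (z (T j)) r (T j) = 0 /\ pderiv 0 1 (z (T j)) r (T j) = 0.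
    move=> r0; split; last by case: (z0 r r0).
    have d0 : is_derive r 1 (fun x => z (T j) x (T j)) 0.
      apply: (@is_derive_locally_cst _ _ _ 0); near=> x.
      by have [] := z0 x _; [near: x; exact: near_gt|].
    by rewrite /pderiv /= derive1E derive_val.
  have [d0 d00 Hd] := energy_estimate Wj cG hsg (tau0 j) zr0 K0 hK (N0 j) (dPhi j) (hN j)
    eta0 (rho0 j).
  exists (Num.min d0 j.+1%:R^-1); split.
  - by rewrite lt_min d00 invr_gt0 ltr0Sn.
  - by rewrite ge_min lexx orbT.
  have := Hd (Num.min d0 j.+1%:R^-1); rewrite lt_min d00 invr_gt0 ltr0Sn ge_min lexx => /(_ isT).
  rewrite Ttau => /le_trans; apply; rewrite lee_fin /bd ler_pM2l//.
  apply: lerXn2r; rewrite ?nnegrE; have := Phi_bd j; have := Phi_mono j; have := eta0.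
  - by clear; lra.
  - by clear; lra.
  - by clear; lra.
have /choice[dl Hdl] := cut.
pose f (j : nat) r := (pderiv 1 0 (z (T j)) r t ^+ 2 + pderiv 0 1 (z (T j)) r t ^+ 2)
       * (inner_cutoff (dl j) r * outer_cutoff (rho j) (r + tau j)) * r ^+ n.-1.
have hT : T j @[j --> \oo] --> B.
  by rewrite -(cvg_shiftn k (fun j : nat => - sg * j%:R : R)) in hB.
pose h j : R := j.+1%:R^-1.
have hcvg : h j @[j --> \oo] --> 0 by exact: cvg_harmonic.
have xrho r : (r + tau j) / rho j @[j --> \oo] --> 0.
  rewrite (_ : (fun j => _) = (fun j => h j + (r + k%:R - `|t| - 1) * (h j * h j))).
    have -> : 0 = 0 + (r + k%:R - `|t| - 1) * (0 * 0) :> R by ring.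
    by apply: cvgD; [exact: hcvg|apply: cvgM; [exact: cvg_cst|exact: cvgM]].
  apply/funext => j; rewrite /tau /rho /h jk.
  have jn : j.+1%:R != 0 :> R by rewrite pnatr_eq0.
  rewrite -natr1 in jn *; by field.
have cf r : 0 < r -> f j r @[j --> \oo] -->
    (pderiv 1 0 w r t ^+ 2 + pderiv 0 1 w r t ^+ 2) * r ^+ n.-1.
  move=> r0.
  have z10 : pderiv 1 0 (z (T j)) r t @[j --> \oo] --> pderiv 1 0 w r t.
    exact: (cvg_comp _ _ hT (zw 1%N 0%N r t isT r0)).
  have z01 : pderiv 0 1 (z (T j)) r t @[j --> \oo] --> pderiv 0 1 w r t.
    exact: (cvg_comp _ _ hT (zw 0%N 1%N r t isT r0)).
  have ci : inner_cutoff (dl j) r @[j --> \oo] --> (1 : R).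
    apply: cvg_near_cst; near=> j; have [d1 d2 _] := Hdl j.
    have hr : h j <= r / 2.
      near: j; move/cvgr0Pnorm_le : hcvg => /(_ (r / 2) ltac:(lra)).
      by apply: filterS => j; apply: le_trans; exact: ler_norm.
    have dr : 2 * dl j <= r by rewrite mulrC -ler_pdivlMr//; exact: le_trans hr.
    by have [->] := inner_cutoff_large d1 dr.
  have -> : (pderiv 1 0 w r t ^+ 2 + pderiv 0 1 w r t ^+ 2) * r ^+ n.-1 =
    (pderiv 1 0 w r t * pderiv 1 0 w r t + pderiv 0 1 w r t * pderiv 0 1 w r t) * (1 * 1)
      * r ^+ n.-1 by ring.
  apply: cvgM; last exact: cvg_cst.
  apply: cvgM; first exact: (cvgD (cvgM z10 z10) (cvgM z01 z01)).
  by apply: cvgM; [exact: ci|exact: cvg_outer_cutoff].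
have Rpos : measurable (`]0, +oo[ : set R) by exact: measurable_itv.
have mf j : measurable_fun (`]0, +oo[ : set R) (fun r => (f j r)%:E).
  apply/measurable_EFinP; apply: open_continuous_measurable_fun.
    exact: interval_open.
  move=> r; rewrite inE /= in_itv/= andbT => r0.
  have [Wj _ _] := hz (T j); have [_ _ czr czt] := C1_OmegaP Wj.1.
  have ci : continuous_Omega (fun r _ : R => inner_cutoff (dl j) r).
    by apply: continuous_Omega_fst => x _; exact: is_derive_continuous (is_derive_inner_cutoff _ _).
  have co : continuous_Omega (fun r _ : R => outer_cutoff (rho j) (r + tau j)).
    apply: continuous_Omega_fst => x _.
    exact: is_derive_continuous (is_derive_shift (is_derive_outer_cutoff (rho j) (x + tau j))).
  have cF : continuous_Omega (fun r s => (pderiv 1 0 (z (T j)) r s ^+ 2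
     + pderiv 0 1 (z (T j)) r s ^+ 2)
       * (inner_cutoff (dl j) r * outer_cutoff (rho j) (r + tau j)) * r ^+ n.-1).
    apply: continuous_OmegaM; last exact: continuous_Omega_pow.
    apply: continuous_OmegaM; last exact: continuous_OmegaM.
    by apply: continuous_OmegaD; apply: continuous_OmegaM.
  exact: (@continuous_Omega_l R _ r t cF r0).
have f0 (j : nat) (r : R) : [set` `]0, +oo[%R] r -> (0 <= (f j r)%:E)%E.
  rewrite /= in_itv/= andbT => r0; rewrite lee_fin.
  apply: mulr_ge0; last exact: exprn_ge0 (ltW r0).
  apply: mulr_ge0; first by rewrite addr_ge0 ?sqr_ge0.
  by apply: mulr_ge0; [case/andP: (inner_cutoff_bounds (dl j) r)|exact: outer_cutoff_ge0].
have := @fatou _ _ R mu _ Rpos (fun j r => (f j r)%:E) mf f0.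
have -> : (\int[mu]_(r in `]0%R, +oo[) limn_einf (fun j => (f j r)%:E) =
   \int[mu]_(r in `]0%R, +oo[)
           ((`|pderiv 1 0 w r t| ^+ 2 + `|pderiv 0 1 w r t| ^+ 2)
            * r ^+ n.-1)%:E)%E.
  apply: eq_integral => r; rewrite inE /= in_itv/= andbT => r0.
  rewrite !real_normK ?num_real//.
  have cE : (f j r)%:E @[j --> \oo] -->
      ((pderiv 1 0 w r t ^+ 2 + pderiv 0 1 w r t ^+ 2) * r ^+ n.-1)%:E.
    by apply: cvg_EFin; [exact: nearW|exact: cf].
  by have [-> _] := cvg_limn_einf_sup cE.
move=> fat.
have lim_le : (limn_einf (fun j => \int[mu]_(r in `]0%R, +oo[) (f j r)%:E) <= bd%:E)%E.
  by apply: limn_einf_ub => j; have [_ _] := Hdl j.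
have bd0 : 0 <= bd by rewrite /bd mulr_ge0 ?sqr_ge0.
have := le_trans fat lim_le; rewrite /energy_norm; set I := (X in (X <= _)%E -> _) => Ibd.
have I0 : (0 <= I)%E.
  apply: integral_ge0 => r; rewrite /= in_itv/= andbT => r0; rewrite lee_fin.
  by apply: mulr_ge0; [rewrite addr_ge0 ?sqr_ge0|exact: exprn_ge0 (ltW r0)].
apply: (@le_trans _ _ (poweR bd%:E 2^-1)).
  by apply: gt0_ler_poweR => //; rewrite in_itv/= ?leey ?andbT// lee_fin.
rewrite poweR_EFin lee_fin powR12_sqrt//.
have Meta : 0 <= (2 + M / th) * eta.
  by rewrite mulr_ge0 ?ltW// addr_gt0// divr_gt0.
rewrite -/eta -mulrA /bd; set X := (2 + M / th) * eta in Meta *.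
have X2 : 0 <= 2 * X by rewrite mulr_ge0.
rewrite -[leRHS](ger0_norm X2) -sqrtr_sqr ler_sqrt ?sqr_ge0//.
by have := sqr_ge0 X; clear; lra.
Unshelve. all: by end_near.
Qed.

End DuhamelEnergy.

(** * The theorem *)

Section Hypotheses.
Context {R : realType}.
Local Notation mu := (@lebesgue_measure R).

(** The equation for pn reads pn ((N - 1)(pn - 1) - 2) = 2. With a + m = (n - 1) / 2 this yields the
    positivity of the first entry of [theta]. *)
Lemma strauss_gt (N pn : R) : 1 < N -> 0 < pn -> (N - 1) * pn ^+ 2 = (N + 1) * pn + 2 ->
  2 < (N - 1) * (pn - 1).
Proof.
move=> N1 pn0 H; have h : 0 < pn * ((N - 1) * (pn - 1) - 2).
  by have -> : pn * ((N - 1) * (pn - 1) - 2) = (N - 1) * pn ^+ 2 - (N + 1) * pn; [ring|lra].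
by move: h; rewrite pmulr_rgt0//; lra.
Qed.

(** The last quantity is the exponent of [r] in [|u|^(2p) r^(n-1)] near the axis. *)
Lemma parameter_bounds (n : nat) (pn p k : R) : (4 <= n)%N ->
  0 < pn /\ (n%:R - 1) * pn ^+ 2 = (n%:R + 1) * pn + 2 ->
  pn < p /\ p < 1 + 4 / (n%:R - 1) -> m_par R n + 1 < k ->
  let a := a_par R n in let m := m_par R n in
  [/\ 0 < m, 1 < p, 1 < (a + m) * (p - 1), (a + m) * (p - 1) <= 2 &
   [/\ 0 < k - m - a & - 1 < 2 * p * (1 - m) + 2 * m + 2 * a]].
Proof.
move=> n4 [pn0 hpn] [pp1 pp2] hkm a m.
have N4 : 4 <= n%:R :> R by rewrite (ler_nat R 4 n).
have N1 : 1 < n%:R :> R by lra.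
have s1 := strauss_gt N1 pn0 hpn.
have Np : 0 < n%:R - 1 :> R by lra.
have s2 : 2 < (n%:R - 1) * (p - 1).
  by apply: (lt_trans s1); rewrite ltr_pM2l//; lra.
have s3 : (n%:R - 1) * (p - 1) < 4.
  by rewrite mulrC -ltr_pdivlMr//; lra.
have p1 : 1 < p.
  have : 0 < (n%:R - 1) * (p - 1) by lra.
  by rewrite pmulr_rgt0//; lra.
have am : a + m = (n%:R - 1) / 2 by rewrite /a /m /a_par /m_par; case: ifP => _; field.
split; rewrite ?am.
- by rewrite /m /m_par; case: ifP => _; lra.
- exact: p1.
- by rewrite mulrAC; lra.
- by rewrite mulrAC; lra.
(* Because (n - 1)(p - 1) < 4, the exponent at the axis exceeds 4p - 4 for odd n and 3p - 4 for even
   n, and p > 1. *)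
- move: hkm; rewrite /a /m /a_par /m_par; case: ifP => _ hkm; split; try lra.
Qed.

Lemma in_X_bound n (k : R) (u : R -> R -> R) : in_X n k u ->
  [/\ normX n k u \is a fin_num, 0 <= fine (normX n k u) &
   forall r t, 0 < r -> `|u r t| <= fine (normX n k u) * r `^ (1 - m_par R n) * (jap r)^-1
     * (jap (`|t| + r) `^ a_par R n * jap (`|t| - r) `^ (k - m_par R n - a_par R n))^-1].
Proof.
move=> [_]; rewrite /normX big_ltn// big_nat1.
set S0 := ereal_sup _; set S1 := ereal_sup _ => fin.
have W0 r s : 0 < weight n k r s by rewrite /weight mulr_gt0// powR_gt0// jap_gt0.
(* Nonnegativity of both suprema makes their sum a finite number and lets the term j = 0 be bounded
   by the whole norm. *)
have ge0 j : (0 <= ereal_sup [set ((`|pderiv j 0 u z.1 z.2|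
                     * z.1 `^ (m_par R n - 1 + j%:R)
                     * jap z.1 `^ (1 - j%:R)
                     * weight n k z.1 `|z.2|)%:E : \bar R)
              | z in [set z : R * R | 0 < z.1]%R])%E.
  pose g (z : R * R) : \bar R := (`|pderiv j 0 u z.1 z.2| * z.1 `^ (m_par R n - 1 + j%:R)
    * jap z.1 `^ (1 - j%:R) * weight n k z.1 `|z.2|)%:E.
  apply: (@le_trans _ _ (g (1, 0))).
    rewrite lee_fin; apply: mulr_ge0; last exact: ltW.
    by do 2![apply: mulr_ge0; last exact: powR_ge0].
  by apply: ereal_sup_ubound; exists (1, 0); first exact: ltr01.
have S00 : (0 <= S0)%E := ge0 0%N.
have S10 : (0 <= S1)%E := ge0 1%N.
have fS : (S0 + S1)%E \is a fin_num by rewrite ge0_fin_numE ?adde_ge0.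
split => //; first by rewrite fine_ge0// adde_ge0.
move=> r t r0.
have : ((`|u r t| * r `^ (m_par R n - 1) * jap r * weight n k r `|t|)%:E <= S0 + S1)%E.
  apply: (@le_trans _ _ S0); last by rewrite leeDl.
  apply: ereal_sup_ubound; exists (r, t) => //=.
  by rewrite /pderiv /= addr0 subr0 powRr1// ltW// jap_gt0.
rewrite -(fineK fS) lee_fin; set U := fine _ => hU.
have rp : 0 < r `^ (m_par R n - 1) by rewrite powR_gt0.
have -> : r `^ (1 - m_par R n) = (r `^ (m_par R n - 1))^-1 by rewrite -powRN opprB.
rewrite !ler_pdivlMr ?jap_gt0//; last exact: W0.
by apply: le_trans hU; rewrite /weight le_eqVlt; apply/orP; left; apply/eqP; ring.
Qed.

(** By the mean value theorem on [-|x|, |x|], where |F'| is largest allowed at the ends; integrating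
    F' would save the factor p, which is irrelevant here. *)
Lemma lipschitz_power_bound (F : R -> R) (A p : R) : 1 < p -> 0 < A -> C1_line F -> F 0 = 0 ->
  derive1 F 0 = 0 ->
  (forall x y : R, `|derive1 F x - derive1 F y| <= A * p * `|x - y| `^ (p - 1)) ->
  forall x, `|F x| <= A * p * `|x| `^ p.
Proof.
move=> p1 A0 [dF _] F0 dF0 hF x.
have dFx (y : R) : is_derive y 1 F (derive1 F y).
  by rewrite derive1E; exact: derivableP.
have Ap : 0 <= A * p by rewrite mulr_ge0 ?ltW//; lra.
have := @MVT_bound R F (derive1 F) (- `|x|) `|x| (A * p * `|x| `^ (p - 1)).
move=> /(_ (fun y _ => dFx y)).
have bd y : - `|x| <= y <= `|x| -> `|derive1 F y| <= A * p * `|x| `^ (p - 1).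
  rewrite -ler_norml => yx; have := hF y 0; rewrite dF0 !subr0 => /le_trans; apply.
  by apply: ler_wpM2l => //; apply: ge0_ler_powR; rewrite ?nnegrE//; lra.
move=> /(_ bd x 0); rewrite -!ler_norml lexx normr0 normr_ge0 F0 !subr0 => /(_ isT isT).
by move/le_trans; apply; rewrite -mulrA [_ * `|x|]mulrC mulr_powRB1//; lra.
Qed.

Lemma cvg_natN_ninfty : (fun j : nat => - 1 * j%:R : R) @ \oo --> ninfty_nbhs R.
Proof.
move=> P [M [_ HM]]; exists (Num.trunc `|M|).+1 => // j /= Mj; apply: HM.
rewrite mulN1r ltrNl; apply: (le_lt_trans (ler_norm _)); rewrite normrN.
by apply: (@lt_le_trans _ _ (Num.trunc `|M|).+1%:R); [exact: truncnS_gt|rewrite ler_nat].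
Qed.

Lemma cvg_nat_pinfty : (fun j : nat => - (- 1) * j%:R : R) @ \oo --> pinfty_nbhs R.
Proof.
move=> P [M [_ HM]]; exists (Num.trunc `|M|).+1 => // j /= Mj; apply: HM.
rewrite opprK mul1r; apply: (le_lt_trans (ler_norm _)).
by apply: (@lt_le_trans _ _ (Num.trunc `|M|).+1%:R); [exact: truncnS_gt|rewrite ler_nat].
Qed.

Lemma energy_norm0 n (w : R -> R -> R) t :
  (forall r, 0 < r -> pderiv 1 0 w r t = 0 /\ pderiv 0 1 w r t = 0) ->
  energy_norm n w t = 0%E.
Proof.
move=> w0; rewrite /energy_norm integral0_eq; first by rewrite poweR_EFin powR0// invr_eq0.
move=> r h; have r0 : 0 < r by move: h; rewrite /= in_itv/= andbT.
have [-> ->] := w0 r r0.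
by rewrite normr0 expr0n addr0 mul0r.
Qed.

Lemma D_bound0 n (k : R) (w : R -> R -> R) : D_bound n k 0 w ->
  forall r t, 0 < r -> pderiv 1 0 w r t = 0 /\ pderiv 0 1 w r t = 0.
Proof.
move=> h r t r0; have h1 := h 1%N 0%N r t isT r0; have h2 := h 0%N 1%N r t isT r0.
by rewrite !mul0r in h1 h2; split; apply/eqP; rewrite -normr_le0.
Qed.

Lemma continuous_source (F V : R -> R) (u : R -> R -> R) : C1_line F -> Ck_pos 1 V ->
  C1_Omega u -> continuous_Omega (source F V u).
Proof.
move=> [dF _] cV /C1_OmegaP/C1_partials_continuous cu.
apply: continuous_OmegaB.
  apply: continuous_Omega_comp cu => x.
  by apply: differentiable_continuous; apply/derivable1_diffP.
apply: continuous_OmegaM => //; apply: continuous_Omega_fst => r r0.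
apply: differentiable_continuous; apply/derivable1_diffP.
by have [h _] := cV r r0; exact: (h 0%N isT).
Qed.

End Hypotheses.

(** With q = theta + 1 as the decay rate of the source in L^2, these are the two upper bounds on q
    that [source_decay] requires, as a + nu = k - m. *)
Lemma theta_bounds (R : realType) (n : nat) (k p : R) :
  [/\ theta n k p + 1 <= (a_par R n + m_par R n) * (p - 1) & theta n k p + 1 <= k - m_par R n].
Proof.
have h : theta n k p <= theta n k p by [].
by move: h; rewrite {2}/theta !le_min => /and3P[h1 h2 h3]; split; lra.
Qed.

Lemma theta_gt0 (R : realType) (n : nat) (pn k p : R) : (4 <= n)%N ->
  0 < pn /\ (n%:R - 1) * pn ^+ 2 = (n%:R + 1) * pn + 2 ->
  pn < p /\ p < 1 + 4 / (n%:R - 1) -> m_par R n + 1 < k -> 0 < theta n k p.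
Proof.
move=> n4 hpn hp hkm; have [m0 p1 am1 am2 _] := parameter_bounds n4 hpn hp hkm.
rewrite /theta !lt_min; apply/and3P; split; try lra.
have h : 0 < (k - m_par R n - 1) * p by apply: mulr_gt0; lra.
by lra.
Qed.

Lemma source_energy_bound (R : realType) (n : nat) (pn p k A kappa V0 : R) (F V : R -> R)
  (u : R -> R -> R) : (4 <= n)%N ->
  0 < pn /\ (n%:R - 1) * pn ^+ 2 = (n%:R + 1) * pn + 2 ->
  pn < p /\ p < 1 + 4 / (n%:R - 1) -> 2 / (p - 1) <= k -> m_par R n + 1 < k ->
  0 < A -> 2 < kappa -> 0 < V0 ->
  C1_line F -> F 0 = 0 -> derive1 F 0 = 0 ->
  (forall x y : R, `|derive1 F x - derive1 F y| <= A * p * `|x - y| `^ (p - 1)) ->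
  Ck_pos 1 V ->
  (forall r : R, 0 < r ->
     \sum_(0 <= i < 2) jap r ^+ i * `|derive1n i V r| <= V0 * jap r `^ (- kappa)) ->
  in_X n k u ->
  exists2 M, 0 < M & forall s c d, 0 < c -> c <= d ->
    \int[@lebesgue_measure R]_(r in `[c, d]) (source F V u r s ^+ 2 * r ^+ n.-1)
      <= (M * jap s `^ (- theta n k p - 1)) ^+ 2.
Proof.
move=> n4 hpn hp hk hkm A0 kap2 V00 cF F0 dF0 hF cV hV hu.
have [m0 p1 am1 am2 [nu0 e1]] := parameter_bounds n4 hpn hp hkm.
have th0 := theta_gt0 n4 hpn hp hkm; have [q1 q2] := theta_bounds n k p.
have /andP[ah a1] := @a_par_bounds R n.
move: m0 am1 am2 nu0 e1 q1 q2 ah a1.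
set a := a_par R n; set m := m_par R n; set th := theta n k p in th0 *.
move=> m0 am1 am2 nu0 e1 q1 q2 ah a1.
have a0 : 0 < a by lra.
have p10 : 0 < p - 1 by lra.
have k2 : 2 <= (m + a + (k - m - a)) * (p - 1).
  by rewrite (_ : m + a + (k - m - a) = k); [rewrite -ler_pdivrMr|ring].
have [fU U0 hU] := in_X_bound hu; set U := fine _ in U0 hU.
(* [source_decay] wants a positive amplitude, but the norm of [u] may be 0. *)
have U1 : 0 < U + 1 by lra.
have Ap0 : 0 <= A * p by rewrite mulr_ge0 ?ltW//; lra.
(* Truncated at 0, since the exponent at the axis may be positive while the profile estimates
   concern -1 < e <= 0. *)
pose e0 := 2 * p * (1 - m) + 2 * m + 2 * a; pose e := Num.min e0 0.
have ele0 : e <= 0 by rewrite ge_min lexx orbT.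
have elee0 : e <= e0 by rewrite ge_min lexx.
have em1 : -1 < e by rewrite lt_min e1; lra.
have q0 : 0 < th + 1 by lra.
have qa : th + 1 <= a + (k - m - a) by lra.
have q22 : th + 1 <= 2 by lra.
have [M M0 HM] := source_decay a0 a1 m0 nu0 p1 kap2 q0 qa q1 q22 k2 U1 Ap0 (ltW V00) ele0 elee0.
pose D := 5 / (e + 1) + 2 * pi : R.
have D0 : 0 <= D.
  by rewrite /D addr_ge0 ?mulr_ge0 ?pi_ge0// invr_ge0; lra.
have cs := continuous_source cF cV hu.1.
(* The estimate is wanted with a square on the right; M D <= (M D + 1)^2 avoids a square root and
   gives positivity. *)
exists (M * D + 1) => [|s c d c0 cd]; first by have := mulr_ge0 M0 D0; lra.
have MD1 : M * D <= (M * D + 1) ^+ 2 by have := mulr_ge0 M0 D0; nra.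
have jq : jap s `^ (- (2 * (th + 1))) = (jap s `^ (- th - 1)) ^+ 2.
  by rewrite !powR_expR ?jap_gt0// expr2 -expRD; congr expR; ring.
have K0 : 0 <= M * jap s `^ (- (2 * (th + 1))) by rewrite mulr_ge0 ?powR_ge0.
have h r : c <= r <= d -> 0 < r by move=> /andP[+ _]; exact: lt_le_trans.
have cg : continuous_Omega (fun r t => source F V u r t ^+ 2 * r ^+ n.-1).
  by apply: continuous_OmegaM; [exact: continuous_OmegaM|exact: continuous_Omega_pow].
apply: le_trans (@Rintegral_decay_profile_le R e `|s| _ c d _ em1 ele0 K0 c0 cd
  (fun r hr => @continuous_Omega_l R _ r s cg (h r hr)) _) _.
  move=> r hr; have r0 := h r hr; rewrite expn_par// /source.
  have js : jap `|s| = jap s by rewrite /jap normr_id.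
  rewrite -js; apply: HM => //.
  - apply: (le_trans (hU r s r0)); rewrite -!mulrA; apply: ler_wpM2r; last by lra.
    by rewrite !mulr_ge0 ?powR_ge0// ?invr_ge0 ?mulr_ge0 ?powR_ge0// ltW// jap_gt0.
  - exact: (lipschitz_power_bound p1 A0 cF F0 dF0 hF).
  - apply: le_trans (hV r r0); rewrite big_ltn// big_nat1 /= expr0 mul1r lerDl.
    by rewrite mulr_ge0// exprn_ge0// ltW// jap_gt0.
by rewrite -/D jq mulrAC exprMn; apply: ler_wpM2r; [exact: sqr_ge0|].
Qed.

Theorem corollary1p6 (R : realType) (n : nat) (hn : (4 <= n)%N)
  (pn p k A kappa : R)
  (hpn : 0 < pn /\ (n%:R - 1) * pn ^+ 2 = (n%:R + 1) * pn + 2)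
  (hp : pn < p /\ p < 1 + 4 / (n%:R - 1))
  (hk0 : 0 < k) (hk : 2 / (p - 1) <= k) (hkm : m_par R n + 1 < k)
  (hA : 0 < A) (hkappa : 2 < kappa) :
  0 < theta n k p /\
  exists delta : R, 0 < delta /\
  forall (V0 eps : R) (F V phi psi : R -> R) (u0m u u0p : R -> R -> R),
    0 < V0 < delta -> 0 < eps < delta ->
    Ck_pos 2 phi -> Ck_pos 1 psi ->
    (forall r : R, 0 < r ->
       \sum_(0 <= i < 3) jap r ^+ i * `|derive1n i phi r|
       + \sum_(0 <= i < 2) jap r ^+ i.+1 * `|derive1n i psi r|
       <= eps * jap r `^ (- k)) ->
    C1_line F -> F 0 = 0 -> derive1 F 0 = 0 ->
    (forall x y : R,
       `|derive1 F x - derive1 F y| <= A * p * `|x - y| `^ (p - 1)) ->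
    Ck_pos 1 V ->
    (forall r : R, 0 < r ->
       \sum_(0 <= i < 2) jap r ^+ i * `|derive1n i V r| <= V0 * jap r `^ (- kappa)) ->
    free_solution_with_data n k eps phi psi u0m ->
    nonlinear_solution n k F V u0m u ->
    scattered_free_solution n k F V u u0p ->
    exists C : R, 0 < C /\
      (forall t : R, t <= 0 ->
         (energy_norm n (fun r s => u r s - u0m r s)%R t
          <= C%:E * normX n k u * (jap t `^ (- theta n k p))%:E)%E) /\
      (forall t : R, 0 <= t ->
         (energy_norm n (fun r s => u r s - u0p r s)%R t
          <= C%:E * normX n k u * (jap t `^ (- theta n k p))%:E)%E).
Proof.
have th0 := theta_gt0 hn hpn hp hkm; split => //.
(* The constant may depend on [u], so the factor [normX] only matters when it
   vanishes, and then [D_bound] makes both energies vanish. *)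
exists 1; split => // V0 eps F V phi psi u0m u u0p /andP[V00 _] _ _ _ _ cF F0 dF0 hF cV hV _
  [uX _ [C1 D1] _ duh1] [_ _ [C2 D2] duh2].
have [fU U0 _] := in_X_bound uX.
have [M M0 HM] := source_energy_bound hn hpn hp hk hkm hA hkappa V00 cF F0 dF0 hF cV hV uX.
have cs := continuous_source cF cV uX.1.
have B0 : 0 < 2 * (2 + M / theta n k p) by rewrite mulr_gt0// addr_gt0// divr_gt0.
rewrite -(fineK fU); set U := fine _ in U0 D1 D2 *.
move: U0; rewrite le_eqVlt => /predU1P[U0|U0].
  exists 1; split => //; rewrite -U0 !mulr0 in D1 D2; rewrite ?mulr0 in D2.
  by rewrite -U0; split => t _; rewrite mule0 mul0e energy_norm0// => r; [exact: (D_bound0 D1)|exact: (D_bound0 D2)].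
exists (2 * (2 + M / theta n k p) / U); split; first exact: divr_gt0.
rewrite -!EFinM divfK ?gt_eqF//.
split => t t0; rewrite -EFinM.
  (* sg = 1 starts from the times -j and requires t <= 0; the mirrored choice sg = - 1 below starts
     from +j. *)
  apply: (@duhamel_energy R n _ _ _ 1 _ M t hn cs _ th0 M0 HM duh1); [by left| |lra].
  exact: cvg_natN_ninfty.
apply: (@duhamel_energy R n _ _ _ (- 1) _ M t hn cs _ th0 M0 HM duh2); [by right| |lra].
exact: cvg_nat_pinfty.
Qed.
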